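(* Let $\delta\in(0,1)$, let the horizon satisfy $\delta=r\Delta x$ with $r\in\mathbb{N}$ and $\Delta x=1/N$, and let $\Delta t=T/N_T$, $t^n=n\Delta t$. Suppose $u(x,t)$ is the strong solution of $$\begin{cases}u_t(x,t)=\mathcal{L}^{qnl}_\delta u(x,t)+f(x,t), & T>t>0,\ x\in(-1,1),\\ u(x,0)=u_0(x), & x\in(-1,1),\\ u(x,t)=0, & x\in[-1-\delta,-1]\ \text{or}\ x=1,\end{cases}$$ and that $u$ is sufficiently smooth, specifically $u\in C^{2}([-1-\delta,1]\times[0,T])$. Let $u_i^n$ be the discrete solution of the scheme $$\frac{u_i^{n+1}-u_i^n}{\Delta t}=\mathcal{L}^{qnl}_{\delta,\Delta x}u_i^n+f(x_i,t^n),\qquad i\in I_\Omega=\{1,\dots,2N-1\},$$ with $u_i^n=0$ for $i\in I_B$. Suppose that at a given time level $t^n=n\Delta t$ one has $u(x_i,t^n)=u_i^n$ for all $i\in I_\Omega$. Then at the next time level $n+1$ the consistency error of the scheme satisfies $$|u_i^{n+1}-u(x_i,t^{n+1})|\le C_\delta\,\Delta t\,\big(\Delta x+\Delta t\big),\qquad \forall\, i=1,\dots,2N-1,$$ where $C_\delta$ is a constant independent of $\Delta x$ and $\Delta t$.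
   Context: Kernel: $\gamma_\delta(s)=\gamma_\delta(|s|)=\frac{1}{\delta^3}\gamma\left(\frac{|s|}{\delta}\right)$, where $\gamma$ is nonnegative and nonincreasing on $(0,1)$, $\mathrm{supp}(\gamma)\subset[0,1]$, normalized so that $\int_0^\delta s^2\gamma_\delta(s)\,ds=1$. Continuous quasi-nonlocal (QNL) operator: $$\mathcal{L}^{qnl}_\delta u(x,t)=\begin{cases}\int_{-\delta}^{\delta}\big(u(x+s,t)-u(x,t)\big)\gamma_\delta(s)\,ds, & x\in(-1,0],\\[4pt] \int_x^\delta\gamma_\delta(s)\big(u(x-s,t)-u(x,t)\big)ds+\Big(\int_x^\delta s\gamma_\delta(s)ds\Big)u_x(x,t)+\Big(\int_0^x s^2\gamma_\delta(s)ds+x\int_x^\delta s\gamma_\delta(s)ds\Big)u_{xx}(x,t), & x\in(0,\delta],\\[4pt] u_{xx}(x,t), & x\in(\delta,1).\end{cases}$$ Grid: $x_i=-1+i\Delta x$, $\Delta x=1/N$, $\delta=r\Delta x$ with $r\in\mathbb{N}$, $\Delta t=T/N_T$, $t^n=n\Delta t$. Index sets: interior $I_\Omega=\{1,\dots,2N-1\}$, nonlocal boundary layer $I_{\Omega_n}=\{-(r-1),\dots,0\}$, local boundary $I_{\Omega_c}=\{2N\}$; $I_B=I_{\Omega_n}\cup I_{\Omega_c}$ and $I=I_\Omega\cup I_B$. Discrete QNL operator, for $i\in I_\Omega$: If $x_i\le 0$ (i.e. $i\in\{1,\dots,N\}$), $$\mathcal{L}^{qnl}_{\delta,\Delta x}u_i^n=\sum_{j=1}^r\frac{u_{i+j}^n-2u_i^n+u_{i-j}^n}{(j\Delta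 x)^2}\int_{(j-1)\Delta x}^{j\Delta x}s^2\gamma_\delta(s)\,ds.$$ If $x_i\in(0,\delta]$ (i.e. $i\in\{N+1,\dots,N+r\}$), $$\mathcal{L}^{qnl}_{\delta,\Delta x}u_i^n=\sum_{j=\frac{x_i}{\Delta x}+1}^{r}\frac{u_{i+j-1}^n-2u_i^n+u_{i-j+1}^n}{2(j-1)\Delta x}\int_{(j-1)\Delta x}^{j\Delta x}s\gamma_\delta(s)ds-\sum_{j=\frac{x_i}{\Delta x}+1}^{r}\frac{u_{i+j-1}^n-u_{i-j+1}^n}{2(j-1)\Delta x}\int_{(j-1)\Delta x}^{j\Delta x}s\gamma_\delta(s)ds$$ $$\qquad+\Big(\int_{x_i}^\delta s\gamma_\delta(s)ds\Big)\frac{u_{i+1}^n-u_i^n}{\Delta x}+\Big(\int_0^{x_i}s^2\gamma_\delta(s)ds+x_i\int_{x_i}^\delta s\gamma_\delta(s)ds\Big)\frac{u_{i+1}^n-2u_i^n+u_{i-1}^n}{(\Delta x)^2}$$ (empty sums are zero; the terms in $u_{i+j-1}^n$ cancel between the two sums, so no value outside the grid is needed). If $x_i\in(\delta,1)$ (i.e. $i\in\{N+r+1,\dots,2N-1\}$), $$\mathcal{L}^{qnl}_{\delta,\Delta x}u_i^n=\frac{u_{i+1}^n-2u_i^n+u_{i-1}^n}{(\Delta x)^2}.$$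
   Formalization: Besides C², u_xx is assumed Lipschitz in x uniformly in t (with C² alone the rate Δx fails), f(x,t)→f(x,0) as t→0+ is assumed for each x in (-1,1) (needed at n=0), and the integral over [-δ,δ] is required to exist as a Lebesgue integral. *)

(* Defs.v *)
From mathcomp Require Import all_boot all_order all_algebra.
From mathcomp Require Import all_classical all_reals all_analysis.

Set Implicit Arguments.
Unset Strict Implicit.
Unset Printing Implicit Defensive.

Import Order.TTheory GRing.Theory Num.Theory numFieldNormedType.Exports.

Local Open Scope classical_set_scope.
Local Open Scope ring_scope.

(* Functions of space and time are curried: [u x t]. *)
Definition dx (R : realType) (u : R -> R -> R) : R -> R -> R :=
  fun x t => derive1 (fun y => u y t) x.

Definition dt (R : realType) (u : R -> R -> R) : R -> R -> R :=
  fun x t => derive1 (fun s => u x s) t.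

(* [extends_cont v]: v, on ]a, b[ x ]c, d[, is the restriction of a function
   that is continuous on [a, b] x [c, d]. *)
Definition extends_cont (R : realType) (a b c d : R) (v : R -> R -> R) : Prop :=
  exists2 g : R * R -> R,
    {within `[a, b] `*` `[c, d], continuous g} &
    forall x t, x \in `]a, b[ -> t \in `]c, d[ -> v x t = g (x, t).

(* All partial derivatives of order at most k exist in the open rectangle and
   extend continuously to the closed one. *)
Fixpoint Ck_rect (R : realType) (k : nat) (a b c d : R) (v : R -> R -> R)
    : Prop :=
  extends_cont a b c d v /\
  match k with
  | 0%N => True
  | k'.+1 =>
      [/\ forall x t, x \in `]a, b[ -> t \in `]c, d[ ->
            derivable (fun y => v y t) x 1 /\ derivable (fun s => v x s) t 1,
          Ck_rect k' a b c d (dx v)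
        & Ck_rect k' a b c d (dt v)]
  end.

(* Membership of u in C^k([a, b] x [c, d]). [Ck_rect] only sees the values of u
   in the open rectangle, hence the first conjunct. *)
Definition Ck_closed_rect (R : realType) (k : nat) (a b c d : R)
    (u : R -> R -> R) : Prop :=
  {within `[a, b] `*` `[c, d], continuous (fun p : R * R => u p.1 p.2)} /\
  Ck_rect k a b c d u.

Definition kern (R : realType) (gamma : R -> R) (delta s : R) : R :=
  (delta ^+ 3)^-1 * gamma (`|s| / delta).

Definition moment (R : realType) (gamma : R -> R) (delta : R) (k : nat)
    (a b : R) : R :=
  \int[lebesgue_measure]_(s in `[a, b]) (s ^+ k * kern gamma delta s).

Record admissible_kernel (R : realType) (gamma : R -> R) (delta : R) : Prop :=
  AdmissibleKernel {
    kernel_ge0 : forall s, s \in `]0, 1[ -> 0 <= gamma s ;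
    kernel_nonincreasing : {in `]0, 1[ &, nonincreasing_fun gamma} ;
    kernel_supp : closure [set s | gamma s != 0] `<=` `[0, 1] ;
    kernel_normalized : moment gamma delta 2 0 delta = 1 }.

(* Meant for x in ]-1, 1[. *)
Definition Lqnl (R : realType) (gamma : R -> R) (delta : R) (u : R -> R -> R)
    (x t : R) : R :=
  if x <= 0 then
    \int[lebesgue_measure]_(s in `[- delta, delta])
      ((u (x + s) t - u x t) * kern gamma delta s)
  else if x <= delta then
    \int[lebesgue_measure]_(s in `[x, delta])
      (kern gamma delta s * (u (x - s) t - u x t))
    + moment gamma delta 1 x delta * dx u x t
    + (moment gamma delta 2 0 x + x * moment gamma delta 1 x delta)
      * dx (dx u) x t
  else dx (dx u) x t.

(* The kernel may be singular at 0, so the existence of the integral over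
   [-delta, delta] as a Lebesgue integral is not automatic; [\int] and the
   derivatives being total functions, it has to be required for the equation to
   be meaningful. All the other integrals in [Lqnl] are over intervals away
   from 0 or carry a weight s^2. *)
Record strong_solution (R : realType) (gamma : R -> R) (delta T : R)
    (f : R -> R -> R) (u0 : R -> R) (u : R -> R -> R) : Prop :=
  StrongSolution {
    sol_integrable : forall x t, x \in `]-1, 0] -> t \in `]0, T[ ->
      lebesgue_measure.-integrable `[- delta, delta]
        (fun s => ((u (x + s) t - u x t) * kern gamma delta s)%:E) ;
    sol_equation : forall x t, x \in `]-1, 1[ -> t \in `]0, T[ ->
      dt u x t = Lqnl gamma delta u x t + f x t ;
    sol_initial : forall x, x \in `]-1, 1[ -> u x 0 = u0 x ;
    sol_boundary : forall x t, x \in `[-1 - delta, -1] \/ x = 1 ->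
      t \in `[0, T] -> u x t = 0 }.

Definition gridx (R : realType) (N : nat) (i : int) : R := -1 + i%:~R / N%:R.

(* Values w i of a grid function at one time level, mesh size 1 / N and horizon
   r / N; meant for 1 <= i <= 2 N - 1. When N < i, x_i / (1 / N) is the natural
   number |i - N|. The values w (i + j - 1) in the second case cancel. *)
Definition Lqnlh (R : realType) (gamma : R -> R) (N r : nat) (w : int -> R)
    (i : int) : R :=
  let h : R := N%:R^-1 in
  let delta : R := r%:R * h in
  let x := gridx R N i in
  if i <= N%:Z then
    \sum_(1 <= j < r.+1)
      (w (i + j%:Z) - 2 * w i + w (i - j%:Z)) / (j%:R * h) ^+ 2
      * moment gamma delta 2 ((j%:R - 1) * h) (j%:R * h)
  else if i <= (N + r)%N%:Z then
    \sum_(`|i - N%:Z|%N.+1 <= j < r.+1)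
      (w (i + j%:Z - 1) - 2 * w i + w (i - j%:Z + 1)) / (2 * (j%:R - 1) * h)
      * moment gamma delta 1 ((j%:R - 1) * h) (j%:R * h)
    - \sum_(`|i - N%:Z|%N.+1 <= j < r.+1)
      (w (i + j%:Z - 1) - w (i - j%:Z + 1)) / (2 * (j%:R - 1) * h)
      * moment gamma delta 1 ((j%:R - 1) * h) (j%:R * h)
    + moment gamma delta 1 x delta * ((w (i + 1) - w i) / h)
    + (moment gamma delta 2 0 x + x * moment gamma delta 1 x delta)
      * ((w (i + 1) - 2 * w i + w (i - 1)) / h ^+ 2)
  else (w (i + 1) - 2 * w i + w (i - 1)) / h ^+ 2.

Definition interior_index (N : nat) (i : int) : Prop :=
  1 <= i <= (2 * N)%N%:Z - 1.

Definition boundary_index (N r : nat) (i : int) : Prop :=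
  - (r%:Z - 1) <= i <= 0 \/ i = (2 * N)%N%:Z.

(* [U n i] is the value at the node x_i at time t^n = n T / NT. *)
Record discrete_solution (R : realType) (gamma : R -> R) (T : R)
    (f : R -> R -> R) (N r NT : nat) (U : nat -> int -> R) : Prop :=
  DiscreteSolution {
    scheme_equation : forall n i, (n < NT)%N -> interior_index N i ->
      (U n.+1 i - U n i) / (T / NT%:R) =
      Lqnlh gamma N r (U n) i + f (gridx R N i) (n%:R * (T / NT%:R)) ;
    scheme_boundary : forall n i, (n <= NT)%N -> boundary_index N r i ->
      U n i = 0 }.

(* Main.v *)
Require Import Defs.
From mathcomp Require Import all_boot all_order all_algebra.
From mathcomp Require Import all_classical all_reals all_analysis.
From mathcomp Require Import measurable_realfun.
From mathcomp Require Import ring lra zify.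

(** Write [h = 1 / N] for the mesh size, [tau = T / NT] for the time step and
    [x = x_i]. If the scheme starts from the exact values at time [t], one step
    commits the error
      [u x (t + tau) - u x t - tau * (L_h u + f)],
    and since [u_t = L u + f] it splits into [u x (t + tau) - u x t - tau * u_t],
    which is [O(tau ^ 2)] because [u_tt] is bounded ([time_taylor]), and
    [tau * (L_h u - L u)]. The point is therefore [|L_h u - L u| = O(h)]
    ([Lqnlh_consistency]).

    The kernel may be singular at the origin; only [s ^ 2 * kern s] is
    integrable. The error estimates are thus made pointwise against a weight and
    integrated afterwards: on each cell the discrete operator replaces a
    difference quotient by its value at a node, so that a Lipschitz bound for the
    quotient is multiplied by [h] and by the mass of the weight
    ([cellwise_quadrature]).

    - For [x <= 0] the reflection [s -> - s] turns the integral into that of the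
      second difference over [0, delta]. Its quotient by [s ^ 2] is a weighted
      mean of [u_xx] over [x - s, x + s], hence Lipschitz in [s]
      ([C21_second_difference_quotient_lip]); the weight [s ^ 2 * kern s] has
      mass one.
    - For [x > delta] the operator is [u_xx] and the claim is Taylor's formula.
    - For [0 < x <= delta] the quotient [(u (x - s) - u x) / s] varies at a rate
      [|u_xx x| + K * s] and the weight is [s * kern s]. The part [K * s] is
      harmless, as it restores the weight [s ^ 2 * kern s]; the other part, and
      likewise the forward difference that stands for [u_x], leaves
      [h * |u_xx x| * m1 x], where [m1 x] is the integral of [s * kern s] over
      [x, delta].

    The product [|u_xx x| * m1 x] has to be bounded uniformly as [x -> 0], where
    [m1 x] may blow up. If [s * kern s] is integrable at the origin, then [m1] is
    bounded. If it is not, the mere existence of [L u] decides: for [x <= 0] the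
    function [(u (x + s) - u x) * kern s = (u_x x * s + O(s ^ 2)) * kern s] is
    integrable, which forces [u_x = 0] on ]-1, 0]; so [u_xx] vanishes up to the
    interface, the Lipschitz condition gives [|u_xx x| <= K * x] beyond it, and
    [x * m1 x] is at most the second moment, that is, at most one
    ([second_derivative_moment_bound]).

    At [t = 0] the equation is not available. The estimate is then obtained for
    small [t > 0], with a step that ends at [tau], and passes to the limit,
    because the discrete operator is a continuous function of the grid values
    ([Lqnlh_cvg]). *)

Set Implicit Arguments.
Unset Strict Implicit.
Unset Printing Implicit Defensive.

Import Order.TTheory GRing.Theory Num.Theory numFieldNormedType.Exports.
Local Open Scope classical_set_scope.
Local Open Scope ring_scope.

(** * Calculus for functions with a Lipschitz second derivative *)

(** The regularity class C^{2,1} of the spatial slices: the second derivative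
    [v2] is [K]-Lipschitz inside, while at the end points of the segment [v] is
    merely continuous, since the last stencil uses the boundary node [x = 1]. *)
Record C21 (R : realType) (a b K : R) (v v1 v2 : R -> R) : Prop := MkC21 {
  C21_ge0 : 0 <= K ;
  C21_cont : {within `[a, b], continuous v} ;
  C21_derive : forall x, x \in `]a, b[ -> is_derive x (1 : R) v (v1 x) ;
  C21_derive2 : forall x, x \in `]a, b[ -> is_derive x (1 : R) v1 (v2 x) ;
  C21_lip : forall x y, x \in `]a, b[ -> y \in `]a, b[ ->
    `|v2 x - v2 y| <= K * `|x - y| }.

(** Neither order of [x] and [y] is singled out, so that the same statement
    serves backward and forward differences. *)
Lemma MVT_between (R : realType) (f df : R -> R) (x y : R) :
  (forall z, z \in `]Num.min x y, Num.max x y[ -> is_derive z (1 : R) f (df z)) ->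
  {within `[Num.min x y, Num.max x y], continuous f} ->
  exists2 c, c \in `[Num.min x y, Num.max x y] & f y - f x = df c * (y - x).
Proof.
have [xy|yx|->] := ltgtP x y => hd hc.
- by have [c cxy ->] := MVT xy hd hc; exists c => //; apply: subset_itv_oo_cc.
- have [c cxy E] := MVT yx hd hc; exists c; first exact: subset_itv_oo_cc.
  by rewrite -opprB E -mulrN opprB.
- by exists y; rewrite ?in_itv /= ?lexx // !subrr mulr0.
Qed.

(** The stencil at the last interior node reaches the boundary node, where [f] is
    only known to be continuous; hence the asymmetry between [x] and [y]. *)
Lemma MVT_closed (R : realType) (f df : R -> R) (a b x y : R) :
  (forall z, z \in `]a, b[ -> is_derive z (1 : R) f (df z)) ->
  {within `[a, b], continuous f} -> x \in `]a, b[ -> y \in `[a, b] ->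
  exists2 c, c \in `]a, b[ & `|c - x| <= `|y - x| /\ f y - f x = df c * (y - x).
Proof.
rewrite !in_itv /= => hd hc /andP[ax xb] /andP[ay yb].
have sub p q : a <= p -> q <= b ->
    (forall z, z \in `]p, q[ -> is_derive z (1 : R) f (df z)) /\
    {within `[p, q], continuous f}.
  move=> ap qb; split.
    move=> z; rewrite in_itv /= => /andP[yz zx]; apply: hd.
    by rewrite in_itv/=; apply/andP; split; lra.
  by apply: (continuous_subspaceW _ hc); apply: subset_itvScc; rewrite bnd_simp.
have [xy|yx|<-] := ltgtP x y; last first.
- by exists x; rewrite ?in_itv /= ?ax ?xb // !subrr mulr0.
- have [hd' hc'] := sub _ _ ay (ltW xb).
  have [c] := MVT yx hd' hc'; rewrite in_itv /= => /andP[yc cx] E.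
  exists c; first by rewrite in_itv/=; apply/andP; split; lra.
  split; first by rewrite !ltr0_norm ?subr_lt0 //; lra.
  by rewrite -opprB E -mulrN opprB.
- have [hd' hc'] := sub _ _ (ltW ax) yb.
  have [c] := MVT xy hd' hc'; rewrite in_itv /= => /andP[yc cx] E.
  exists c; first by rewrite in_itv/=; apply/andP; split; lra.
  by split=> //; rewrite !gtr0_norm ?subr_gt0 //; lra.
Qed.

Lemma MVT_open (R : realType) (f df : R -> R) (a b x y : R) :
  (forall z, z \in `]a, b[ -> is_derive z (1 : R) f (df z)) ->
  x \in `]a, b[ -> y \in `]a, b[ ->
  exists2 c, c \in `]a, b[ &
    [/\ `|c - x| <= `|y - x|, `|c - y| <= `|y - x| & f y - f x = df c * (y - x)].
Proof.
move=> hd xab yab.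
have sub (z : R) : z \in `[Num.min x y, Num.max x y] -> z \in `]a, b[.
  by move: xab yab; rewrite !in_itv /=; case: (leP x y) => _; lra.
have hd' z : z \in `]Num.min x y, Num.max x y[ -> is_derive z (1 : R) f (df z).
  by move=> zxy; apply/hd/sub/subset_itv_oo_cc.
have hc : {within `[Num.min x y, Num.max x y], continuous f}.
  by apply: derivable_within_continuous => z /sub zab; case: (hd _ zab).
have [c cc E] := MVT_between hd' hc.
have ? := sub _ cc.
exists c => //; move: cc; rewrite in_itv /=; case: (leP x y) => xy /andP[c1 c2].
- by split=> //; rewrite [leRHS]ger0_norm ?subr_ge0 // ler_norml; apply/andP; split; lra.
- by split=> //; rewrite [leRHS]ltr0_norm ?subr_lt0 // ler_norml; apply/andP; split; lra.
Qed.

Lemma is_derive_affine (R : realType) (f : R -> R) (x e th d : R) :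
  is_derive (x + th * e) (1 : R) f d ->
  is_derive th (1 : R) (fun th => f (x + th * e)) (e * d).
Proof.
move=> fd.
have H : is_derive th (1 : R) (fun th : R => x + th * e) e.
  by apply: is_derive_eq; rewrite /GRing.scale /=; ring.
by rewrite mulrC; exact: (@is_derive1_comp _ f (fun th => x + th * e) th d e).
Qed.

Lemma first_order_bound (R : realType) (G G1 : R -> R) (M : R) :
  (forall th : R, th \in `[0, 1] -> is_derive th (1 : R) G (G1 th)) ->
  (forall th : R, th \in `[0, 1] -> `|G1 th| <= M) -> `|G 1 - G 0| <= M.
Proof.
move=> dG bG.
have dG' (z : R) : z \in `]0, 1[ -> is_derive z (1 : R) G (G1 z).
  by move=> z01; apply: dG; apply: subset_itv_oo_cc.
have cG : {within `[0, 1], continuous G}.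
  by apply: derivable_within_continuous => z z01; case: (dG z z01).
have [c c01 ->] := MVT ltr01 dG' cG.
by rewrite subr0 mulr1 bG //; apply: subset_itv_oo_cc.
Qed.

(** The mean value theorem applied twice on [0, 1]. Inequalities between
    difference quotients with steps [s] and [s'] follow by taking for [G th] the
    difference of the quotients with numerators at [th * s] and [th * s'] and
    denominators kept fixed, which avoids differentiating a quotient. *)
Lemma second_order_bound (R : realType) (G G1 G2 : R -> R) (M : R) :
  (forall th : R, th \in `[0, 1] -> is_derive th (1 : R) G (G1 th)) ->
  (forall th : R, th \in `[0, 1] -> is_derive th (1 : R) G1 (G2 th)) ->
  G 0 = 0 -> G1 0 = 0 ->
  (forall th : R, th \in `[0, 1] -> `|G2 th| <= M) -> `|G 1| <= M.
Proof.
move=> dG dG1 G0 G10 bG; rewrite -[G 1]subr0 -G0.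
apply: (first_order_bound dG) => th th01.
have [c c01 E] : exists2 c, c \in `[0, 1] & G1 th = G2 c * th.
  have sub (z : R) : z \in `[Num.min 0 th, Num.max 0 th] -> z \in `[0, 1].
    by move: th01; rewrite !in_itv /=; case: (leP 0 th) => ?; lra.
  have d1 (z : R) : z \in `]Num.min 0 th, Num.max 0 th[ -> is_derive z (1 : R) G1 (G2 z).
    by move=> zxy; apply/dG1/sub/subset_itv_oo_cc.
  have c1 : {within `[Num.min 0 th, Num.max 0 th], continuous G1}.
    by apply: derivable_within_continuous => z /sub zab; case: (dG1 _ zab).
  have [c cc] := MVT_between d1 c1; rewrite G10 !subr0 => E.
  by exists c => //; exact: sub.
move: th01; rewrite E normrM in_itv /= => /andP[t0 t1].
by rewrite (ger0_norm t0) (le_trans _ (bG _ c01)) // ler_piMr.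
Qed.

Section C21_estimates.
Context (R : realType) (a b K : R) (v v1 v2 : R -> R).
Hypothesis hv : C21 a b K v v1 v2.

(** Two applications of the mean value theorem to the remainder produce
    [(v2 d - v2 x) * (c - x) * (y - x)] with [c] and [d] between [x] and [y]. *)
Lemma C21_taylor x y : x \in `]a, b[ -> y \in `[a, b] ->
  `|v y - v x - (y - x) * v1 x - (y - x) ^+ 2 / 2 * v2 x| <= K * `|y - x| ^+ 3.
Proof.
move=> xab yab.
pose g z := v z - (z - x) * v1 x - (z - x) ^+ 2 / 2 * v2 x.
pose dg z := v1 z - v1 x - (z - x) * v2 x.
have hd z : z \in `]a, b[ -> is_derive z (1 : R) g (dg z).
  move=> /(C21_derive hv) ?.
  by apply: is_derive_eq; rewrite /dg /GRing.scale /=; field.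
have hc : {within `[a, b], continuous g}.
  pose p z := (z - x) * v1 x + (z - x) ^+ 2 / 2 * v2 x.
  have -> : g = v \- p by apply/funext => z; rewrite /g /p /=; ring.
  move=> z; apply: continuousB; first exact: (C21_cont hv).
  apply: continuous_subspaceT => {}z; apply: differentiable_continuous.
  by apply/derivable1_diffP; rewrite /p.
have [c cab [cx E]] := MVT_closed hd hc xab yab.
have [d dab [dx _ E2]] := MVT_open (C21_derive2 hv) xab cab.
have -> : v y - v x - (y - x) * v1 x - (y - x) ^+ 2 / 2 * v2 x
          = (v2 d - v2 x) * (c - x) * (y - x).
  transitivity (g y - g x); first by rewrite /g; ring.
  by rewrite E /dg E2; ring.
rewrite !normrM !exprS expr0 mulr1 !mulrA.
apply: ler_wpM2r => //; apply: ler_pM => //.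
by rewrite (le_trans (C21_lip hv _ _)) // ler_wpM2l ?(C21_ge0 hv) ?(le_trans dx).
Qed.

Lemma C21_second_difference x h : x \in `]a, b[ -> x + h \in `[a, b] -> x - h \in `[a, b] ->
  `|v (x + h) - 2 * v x + v (x - h) - h ^+ 2 * v2 x| <= 2 * K * `|h| ^+ 3.
Proof.
move=> xab hp hm.
have := C21_taylor xab hp; have := C21_taylor xab hm.
have -> : x - h - x = - h by ring.
have -> : x + h - x = h by ring.
rewrite normrN => A B.
rewrite (_ : _ - _ = (v (x + h) - v x - h * v1 x - h ^+ 2 / 2 * v2 x) +
  (v (x - h) - v x - - h * v1 x - (- h) ^+ 2 / 2 * v2 x)); last by field.
by rewrite (le_trans (ler_normD _ _))//; lra.
Qed.

(** The quotient is the mean of [v2] over [x - s, x + s] with the triangular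
    weight, and enlarging [s] moves every point of the mean by at most
    [s' - s]. *)
Lemma C21_second_difference_quotient_lip x s s' :
  a < x - s' -> x + s' < b -> 0 < s <= s' ->
  `|(v (x + s') - 2 * v x + v (x - s')) / s' ^+ 2
    - (v (x + s) - 2 * v x + v (x - s)) / s ^+ 2| <= 2 * K * (s' - s).
Proof.
move=> axs xsb /andP[s0 ss].
have K0 := C21_ge0 hv.
pose G th := (v (x + th * s') - 2 * v x + v (x + th * - s')) / s' ^+ 2
    - (v (x + th * s) - 2 * v x + v (x + th * - s)) / s ^+ 2.
pose G1 th := (v1 (x + th * s') - v1 (x + th * - s')) / s'
    - (v1 (x + th * s) - v1 (x + th * - s)) / s.
pose G2 th := v2 (x + th * s') + v2 (x + th * - s')
    - (v2 (x + th * s) + v2 (x + th * - s)).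
have sn0 : s != 0 by rewrite gt_eqF.
have s'n0 : s' != 0 by rewrite gt_eqF // (lt_le_trans s0).
have xin (th e : R) : th \in `[0, 1] -> - s' <= e <= s' -> x + th * e \in `]a, b[.
  by rewrite !in_itv /= => /andP[t0 t1] /andP[e0 e1]; apply/andP; split; nra.
have [b1 b2 b3 b4] : [/\ - s' <= s' <= s', - s' <= - s' <= s', - s' <= s <= s'
    & - s' <= - s <= s'] by split; lra.
have dv (e th : R) : - s' <= e <= s' -> th \in `[0, 1] ->
    is_derive th (1 : R) (fun th => v (x + th * e)) (e * v1 (x + th * e)).
  by move=> he hth; apply/is_derive_affine/(C21_derive hv)/xin.
have dv1 (e th : R) : - s' <= e <= s' -> th \in `[0, 1] ->
    is_derive th (1 : R) (fun th => v1 (x + th * e)) (e * v2 (x + th * e)).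
  by move=> he hth; apply/is_derive_affine/(C21_derive2 hv)/xin.
(* At [th = 1] this [G] is the difference of the two quotients. *)
suff : `|G 1| <= 2 * K * (s' - s) by rewrite /G !mul1r.
apply: (@second_order_bound _ G G1 G2).
- move=> th hth.
  have [d1 d2] := (dv _ _ b1 hth, dv _ _ b2 hth).
  have [d3 d4] := (dv _ _ b3 hth, dv _ _ b4 hth).
  rewrite /G; apply: is_derive_eq; rewrite /G1 /GRing.scale /=; field.
  by rewrite sn0 s'n0.
- move=> th hth.
  have [d1 d2] := (dv1 _ _ b1 hth, dv1 _ _ b2 hth).
  have [d3 d4] := (dv1 _ _ b3 hth, dv1 _ _ b4 hth).
  rewrite /G1; apply: is_derive_eq; rewrite /G2 /GRing.scale /=; field.
  by rewrite sn0 s'n0.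
- by rewrite /G !mul0r !addr0; ring.
- by rewrite /G1 !mul0r !addr0 !subrr; ring.
move=> th hth; rewrite /G2 opprD addrACA (le_trans (ler_normD _ _)) //.
have th01 : 0 <= th <= 1 by move: hth; rewrite in_itv.
have A := C21_lip hv (xin _ _ hth b1) (xin _ _ hth b3).
have B := C21_lip hv (xin _ _ hth b2) (xin _ _ hth b4).
rewrite mulr2n mulrDl mul1r mulrDl; apply: lerD.
  apply: (le_trans A); apply: ler_wpM2l => //.
  rewrite (_ : _ - _ = th * (s' - s)); last by ring.
  by rewrite ger0_norm ?mulr_ge0 ?subr_ge0 //; nra.
apply: (le_trans B); apply: ler_wpM2l => //.
rewrite (_ : _ - _ = - (th * (s' - s))); last by ring.
by rewrite normrN ger0_norm ?mulr_ge0 ?subr_ge0 //; nra.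
Qed.

(** The quotient is minus the mean of [v1] over [x - s, x], and [v1] varies at a
    rate at most [|v2 x| + K * s] there. The term [|v2 x|] is kept apart because
    it alone is not absorbed by the second moment of the kernel. *)
Lemma C21_difference_quotient_lip x s s' :
  a < x - s -> x < b -> 0 < s' <= s ->
  `|(v (x - s) - v x) / s - (v (x - s') - v x) / s'|
    <= (`|v2 x| + K * s) * (s - s').
Proof.
move=> axs xb /andP[s0 ss].
have K0 := C21_ge0 hv.
have sn0 : s != 0 by rewrite gt_eqF // (lt_le_trans s0).
have s'n0 : s' != 0 by rewrite gt_eqF.
pose G th := (v (x + th * - s) - v x) / s - (v (x + th * - s') - v x) / s'.
pose G1 th := v1 (x + th * - s') - v1 (x + th * - s).
have xin (th e : R) : th \in `[0, 1] -> 0 <= e <= s -> x + th * - e \in `]a, b[.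
  by rewrite !in_itv /= => /andP[t0 t1] /andP[e0 e1]; apply/andP; split; nra.
have dv (e th : R) : 0 <= e <= s -> th \in `[0, 1] ->
    is_derive th (1 : R) (fun th => v (x + th * - e)) (- e * v1 (x + th * - e)).
  by move=> he hth; apply/is_derive_affine/(C21_derive hv)/xin.
suff : `|G 1 - G 0| <= (`|v2 x| + K * s) * (s - s').
  by rewrite /G !mul1r !mul0r !addr0 !subrr !mul0r !subr0.
apply: (@first_order_bound _ G G1).
- move=> th hth.
  have d1 := dv s th ltac:(lra) hth.
  have d2 := dv s' th ltac:(lra) hth.
  by apply: is_derive_eq; rewrite /G1 /GRing.scale /=; field; rewrite sn0 s'n0.
move=> th hth; have th01 : 0 <= th <= 1 by move: hth; rewrite in_itv.
have i0 : x \in `]a, b[.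
  by rewrite -[x]addr0 -(mul0r (- 0)); apply: xin; rewrite ?in_itv/=; lra.
have i1 := xin _ _ hth (ltac:(lra) : 0 <= s <= s).
have i2 := xin _ _ hth (ltac:(lra) : 0 <= s' <= s).
have [c cab [cX cY E]] := MVT_open (C21_derive2 hv) i1 i2.
have YX : x + th * - s' - (x + th * - s) = th * (s - s') by ring.
have YX0 : 0 <= th * (s - s') by rewrite mulr_ge0 ?subr_ge0 //; lra.
have ts : th * s <= s by nra.
have ts' : 0 <= th * s' by nra.
have cx : `|c - x| <= s.
  move: cX cY; rewrite YX (ger0_norm YX0) !ler_norml => /andP[_ cX] /andP[cY _].
  by move: cX cY; rewrite !mulrN mulrBr => cX cY; apply/andP; split; lra.
have v2c : `|v2 c| <= `|v2 x| + K * s.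
  rewrite -[v2 c](subrK (v2 x)) addrC (le_trans (ler_normD _ _))// lerD2l.
  by rewrite (le_trans (C21_lip hv cab i0)) // ler_wpM2l.
rewrite /G1 E YX normrM (ger0_norm YX0); apply: ler_pM => //; nra.
Qed.
End C21_estimates.

(** * Integrals over segments and cellwise quadrature *)

Section segment_integrals.
Context (R : realType).
Implicit Types (a b c : R) (f g : R -> R).
Local Notation mu := (@lebesgue_measure R).

Definition integrable_on a b f := mu.-integrable `[a, b] (EFin \o f).

Lemma integrable_onS a b c d f :
  a <= c -> d <= b -> integrable_on a b f -> integrable_on c d f.
Proof.
move=> ac db; apply: integrableS => //.
by apply: subset_itvScc; rewrite bnd_simp.
Qed.

Lemma integrable_on_le a b f g : measurable_fun `[a, b] f ->
  (forall x, x \in `[a, b] -> `|f x| <= `|g x|) ->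
  integrable_on a b g -> integrable_on a b f.
Proof.
move=> mf fg; apply: le_integrable => //; first exact/measurable_EFinP.
Qed.

Lemma integrable_onZ a b k f : integrable_on a b f -> integrable_on a b (fun s => k * f s).
Proof. by move=> fi; apply: (integrableZl _ k fi). Qed.

Lemma integrable_onD a b f g : integrable_on a b f -> integrable_on a b g ->
  integrable_on a b (fun s => f s + g s).
Proof. by move=> fi gi; apply: (integrableD _ fi gi). Qed.

Lemma Rintegral_cc_oo a b f : integrable_on a b f ->
  \int[mu]_(s in `[a, b]) f s = \int[mu]_(s in `]a, b[) f s.
Proof.
move=> fi; rewrite -Rintegral_itv_bndo_bndc; last first.
  by apply: integrableS fi => //; exact: subset_itv_co_cc.
rewrite Rintegral_itv_obnd_cbnd //.
by apply: integrableS fi => //; exact: subset_itv_oo_cc.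
Qed.

(** The end points are left out because the kernel is unconstrained at [0] and
    at [delta]; there it may even be negative. *)
Lemma le_Rintegral_oo a b f g : integrable_on a b f -> integrable_on a b g ->
  (forall x, x \in `]a, b[ -> f x <= g x) ->
  \int[mu]_(s in `[a, b]) f s <= \int[mu]_(s in `[a, b]) g s.
Proof.
move=> fi gi fg; rewrite !Rintegral_cc_oo //.
by apply: le_Rintegral => //; [apply: integrableS fi|apply: integrableS gi] => //;
  exact: subset_itv_oo_cc.
Qed.

Lemma Rintegral_chasles a b c f : a <= c <= b -> integrable_on a b f ->
  \int[mu]_(s in `[a, b]) f s =
  \int[mu]_(s in `[a, c]) f s + \int[mu]_(s in `[c, b]) f s.
Proof.
move=> /andP[ac cb] fi; apply/eqP; rewrite addrC -subr_eq; apply/eqP.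
rewrite Rintegral_itvB ?bnd_simp // Rintegral_itv_obnd_cbnd //.
by apply: integrableS fi => //; apply: subset_itvl || apply: subset_itvr; rewrite ?bnd_simp.
Qed.

Lemma opp_preimage_segment a b :
  (-%R : R -> R) @^-1` `[- b, - a]%classic = `[a, b]%classic.
Proof. by apply/seteqP; split=> x /=; rewrite !in_itv /= => /andP[? ?]; lra. Qed.

(** Lebesgue measure is its own image under [s -> - s]. The transfer formula
    wants a function measurable on the whole line, hence the extension of [f] by
    zero. *)
Lemma reflection_integral a b (f : R -> \bar R) :
  mu.-integrable `[- b, - a] f ->
  mu.-integrable `[a, b] (fun s => f (- s)) /\
  (\int[mu]_(s in `[(- b)%R, (- a)%R]) f s = \int[mu]_(s in `[a, b]) f (- s)%R)%E.
Proof.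
move=> fi.
pose g := f \_ `[- b, - a].
have phi : measurable_fun setT (-%R : measurableTypeR R -> measurableTypeR R).
  exact: measurable_funN.
have gi : mu.-integrable setT g.
  exact: ((@integrable_mkcond _ _ _ mu _ f (measurable_itv `[(- b), (- a)])).1 fi).
have mg : measurable_fun setT g by exact: (measurable_int mu).
have mD : measurable `[- b, - a]%classic by [].
have push D' (F : R -> \bar R) : measurable D' ->
    (\int[mu]_(s in D') F s =
     \int[pushforward mu (-%R : measurableTypeR R -> measurableTypeR R)]_(s in D')
       F s)%E.
  move=> mD'; apply: eq_measure_integral => A mA _. exact/esym/lebesgue_measureN.
have gphi : mu.-integrable setT (g \o (-%R : measurableTypeR R -> measurableTypeR R)).
  apply/integrableP; split; first exact: measurableT_comp.
  have /integrableP[_] := gi.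
  rewrite push // ge0_integral_pushforward //; last exact: measurableT_comp.
have e : {in `[a, b]%classic, (fun s => f (- s)) =1 g \o -%R}.
  move=> s; rewrite inE /= in_itv /= => /andP[s1 s2].
  by rewrite /g /restrict /= mem_set //= in_itv /=; apply/andP; split; lra.
split.
  apply: eq_integrable (integrableS _ _ _ gphi) => //.
  by move=> s sab; rewrite e.
transitivity (\int[mu]_(s in `[a, b]) (g \o -%R) s)%E; last first.
  by apply: eq_integral => s sab; rewrite -e.
rewrite -opp_preimage_segment; apply: etrans; last first.
  apply: (integral_pushforward phi) => //; apply: integrableS gphi => //.
  by rewrite opp_preimage_segment.
rewrite -[RHS]push //.
by apply: eq_integral => s sD; rewrite /g /restrict sD.
Qed.

Lemma integrable_on_opp a b f :
  integrable_on (- b) (- a) f -> integrable_on a b (fun s => f (- s)).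
Proof. by move=> /reflection_integral[]. Qed.

Lemma Rintegral_opp a b f : integrable_on (- b) (- a) f ->
  \int[mu]_(s in `[- b, - a]) f s = \int[mu]_(s in `[a, b]) f (- s).
Proof. by move=> /reflection_integral[_ E]; rewrite /Rintegral; congr fine. Qed.

(** The form in which all the quadrature errors below are bounded: a pointwise
    comparison inside each cell, with an error density [H] that carries the
    weight. No bound on [w] itself enters, which is what permits singular
    kernels. *)
Lemma cellwise_quadrature (h : R) (m r : nat) (c : nat -> R) (w G H : R -> R) :
  0 <= h -> (m <= r)%N ->
  integrable_on (m%:R * h) (r%:R * h) w ->
  integrable_on (m%:R * h) (r%:R * h) G ->
  integrable_on (m%:R * h) (r%:R * h) H ->
  (forall j s, (m <= j < r)%N -> s \in `]j%:R * h, j.+1%:R * h[ ->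
     `|c j * w s - G s| <= H s) ->
  `|\sum_(m <= j < r) c j * \int[mu]_(s in `[j%:R * h, j.+1%:R * h]) w s
    - \int[mu]_(s in `[m%:R * h, r%:R * h]) G s|
  <= \int[mu]_(s in `[m%:R * h, r%:R * h]) H s.
Proof.
move=> h0; elim: r => [|r IH].
  rewrite leqn0 => /eqP -> _ _ _ _.
  by rewrite big_nil !set_itv1 !Rintegral_set1 subrr normr0.
rewrite leq_eqVlt => /predU1P[-> _ _ _ _|].
  by rewrite big_geq // !set_itv1 !Rintegral_set1 subrr normr0.
rewrite ltnS => mr wi Gi Hi cGH.
have mrh : m%:R * h <= r%:R * h by rewrite ler_wpM2r // ler_nat.
have rrh : r%:R * h <= r.+1%:R * h by rewrite ler_wpM2r // ler_nat.
have A f : integrable_on (m%:R * h) (r.+1%:R * h) f ->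
    integrable_on (m%:R * h) (r%:R * h) f.
  exact: integrable_onS.
have B f : integrable_on (m%:R * h) (r.+1%:R * h) f ->
    integrable_on (r%:R * h) (r.+1%:R * h) f.
  exact: integrable_onS.
have mid : m%:R * h <= r%:R * h <= r.+1%:R * h by rewrite mrh rrh.
rewrite big_nat_recr //= (Rintegral_chasles mid Gi) (Rintegral_chasles mid Hi).
rewrite opprD addrACA (le_trans (ler_normD _ _)) // lerD //.
  apply: IH => //; [exact: A..|] => j s /andP[mj jr].
  by apply: cGH; rewrite mj ltnS ltnW.
move: (B _ wi) (B _ Gi) (B _ Hi) => {A B}{}wi {}Gi {}Hi.
have wGi : integrable_on (r%:R * h) (r.+1%:R * h) (fun s => c r * w s - G s).
  have := integrable_onD (integrable_onZ (c r) wi) (integrable_onZ (-1) Gi).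
  by congr (integrable_on _ _ _); apply/funext => s; rewrite mulN1r.
have -> : c r * \int[mu]_(s in `[r%:R * h, r.+1%:R * h]) w s
  - \int[mu]_(s in `[r%:R * h, r.+1%:R * h]) G s =
  \int[mu]_(s in `[r%:R * h, r.+1%:R * h]) (c r * w s - G s).
  by rewrite RintegralB ?RintegralZl //; exact: integrable_onZ.
apply: le_trans (le_normr_Rintegral _ wGi) _ => //.
apply: le_Rintegral_oo => //.
  by have := integrable_norm wGi.
by move=> s hs; apply: cGH => //; rewrite mr ltnSn.
Qed.

End segment_integrals.

(** * The kernel and its moments *)

Section kernel.
Context (R : realType) (gamma : R -> R) (delta : R).
Hypothesis (delta_gt0 : 0 < delta) (hgamma : admissible_kernel gamma delta).
Local Notation mu := (@lebesgue_measure R).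
Local Notation kd := (kern gamma delta).
Local Notation mom := (moment gamma delta).

(** Monotone on the open unit interval and zero off the closed one. *)
Lemma measurable_gamma : measurable_fun [set: R] gamma.
Proof.
have -> : [set: R] = `[0, 1] `|` ~` `[0, 1] by rewrite setUv.
apply/measurable_funU => //; first exact: measurableC.
split.
  apply/measurable_fun_itv_bndo_bndcP/measurable_fun_itv_obnd_cbndP.
  apply: (measurability (@RGenCInfty.G R)) => [|/= _ [_] [r] -> <-].
    exact: RGenCInfty.measurableE.
  apply: is_interval_measurable => s t /= [s01 gs] [t01 gt] z /andP[sz zt].
  have z01 : z \in `]0, 1[.
    by move: s01 t01; rewrite !in_itv /= => /andP[? ?] /andP[? ?]; lra.
  split=> //; move: gt; rewrite !in_itv /= !andbT => gt; apply: (le_trans gt).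
  exact: (kernel_nonincreasing hgamma).
have gamma0 : {in ~` `[0, 1], cst 0 =1 gamma}.
  move=> s; rewrite inE /= => s01; apply/esym/eqP/negPn/negP => gs.
  by apply/s01/(kernel_supp hgamma)/subset_closure.
exact: (eq_measurable_fun _ gamma0 (measurable_cst _)).
Qed.

Lemma measurable_kern : measurable_fun [set: R] kd.
Proof.
apply: measurable_funM => //; apply: measurableT_comp; first exact: measurable_gamma.
by apply: measurable_funM => //; exact: measurable_normr.
Qed.

Lemma kern_ge0 s : s \in `]0, delta[ -> 0 <= kd s.
Proof.
rewrite in_itv /= => /andP[s0 sd]; rewrite /kern mulr_ge0 ?invr_ge0 ?exprn_ge0 ?(ltW delta_gt0) //.
rewrite (kernel_ge0 hgamma) // in_itv /= gtr0_norm // divr_gt0 //=.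
by rewrite ltr_pdivrMr // mul1r.
Qed.

Lemma kern_even s : kd (- s) = kd s.
Proof. by rewrite /kern normrN. Qed.

Lemma measurable_pow_kern (k : nat) (D : set R) : measurable_fun D (fun s => s ^+ k * kd s).
Proof.
apply: measurable_funTS; apply: measurable_funM; last exact: measurable_kern.
exact: measurable_funX.
Qed.

(** The real-valued integral is zero by convention when the extended one is
    infinite, so the normalization to [1] contains integrability. *)
Lemma integrable_sqr_kern : integrable_on 0 delta (fun s => s ^+ 2 * kd s).
Proof.
have nn s : s \in `]0, delta[ -> 0 <= s ^+ 2 * kd s.
  by move=> sd; rewrite mulr_ge0 ?sqr_ge0 ?kern_ge0.
apply/integrableP; split; first by apply/measurable_EFinP; apply: measurable_pow_kern.
have m2 : measurable_fun `]0, delta[%classic (fun s => (s ^+ 2 * kd s)%:E).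
  by apply/measurable_EFinP; apply: measurable_pow_kern.
have -> : (\int[mu]_(s in `[0%R, delta]) `|(s ^+ 2 * kd s)%:E| =
           \int[mu]_(s in `[0%R, delta]) (s ^+ 2 * kd s)%:E)%E.
  rewrite !(@integral_itv_bndoo _ _ _ _ true false) //; last exact: measurableT_comp.
  by apply: eq_integral => s; rewrite inE /= => sd; rewrite ger0_norm // nn.
have := kernel_normalized hgamma; rewrite /moment /Rintegral.
case: (integral _ _ _) => [r _|/= /esym/eqP|/= /esym/eqP]; rewrite ?ltry ?oner_eq0 //.
Qed.

(** Away from the origin, [s] is at most [s ^ 2 / x]. *)
Lemma integrable_id_kern x : 0 < x -> integrable_on x delta (fun s => s ^+ 1 * kd s).
Proof.
move=> x0; apply: (@integrable_on_le _ _ _ _ (fun s => x^-1 * (s ^+ 2 * kd s))).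
- exact: measurable_pow_kern.
- move=> s; rewrite in_itv /= => /andP[xs sd].
  have s0 : 0 < s by apply: lt_le_trans xs.
  have -> : x^-1 * (s ^+ 2 * kd s) = (x^-1 * s) * (s ^+ 1 * kd s) by ring.
  rewrite [leRHS]normrM ler_peMl // ger0_norm ?mulr_ge0 ?invr_ge0 ?(ltW x0) ?(ltW s0) //.
  by rewrite ler_pdivlMl // mulr1.
- by apply/integrable_onZ/(integrable_onS (ltW x0) (lexx _))/integrable_sqr_kern.
Qed.

Lemma moment2_split x : 0 <= x <= delta -> mom 2 0 x + mom 2 x delta = 1.
Proof.
move=> x0d; rewrite -(kernel_normalized hgamma) /moment.
by rewrite -Rintegral_chasles //; exact: integrable_sqr_kern.
Qed.

Lemma moment_ge0 k x y : 0 <= x -> y <= delta ->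
  integrable_on x y (fun s => s ^+ k * kd s) -> 0 <= mom k x y.
Proof.
move=> x0 yd ki; rewrite /moment Rintegral_cc_oo //; apply: Rintegral_ge0 => s /=.
rewrite in_itv /= => /andP[xs sy].
have s0 : 0 < s by apply: le_lt_trans xs.
by rewrite mulr_ge0 ?exprn_ge0 ?(ltW s0) // kern_ge0 // in_itv /= s0 (lt_le_trans sy).
Qed.

Lemma moment2_ge0 x y : 0 <= x -> y <= delta -> 0 <= mom 2 x y.
Proof.
by move=> x0 yd; apply: moment_ge0 => //; apply: integrable_onS integrable_sqr_kern.
Qed.

Lemma moment1_ge0 x : 0 < x -> 0 <= mom 1 x delta.
Proof. by move=> x0; apply: moment_ge0; rewrite ?(ltW x0) // integrable_id_kern. Qed.

Lemma moment1_moment2 x : 0 < x -> x * mom 1 x delta <= mom 2 x delta.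
Proof.
move=> x0; rewrite /moment -RintegralZl //; last exact: integrable_id_kern.
apply: le_Rintegral_oo.
- by apply: integrable_onZ; exact: integrable_id_kern.
- by apply: integrable_onS integrable_sqr_kern => //; exact: ltW.
move=> s; rewrite in_itv /= => /andP[xs sd]; have s0 : 0 < s by apply: lt_trans xs.
rewrite expr2 -mulrA expr1; apply: ler_wpM2r; last exact: ltW.
by rewrite mulr_ge0 ?kern_ge0 ?in_itv /= ?s0 ?(ltW s0).
Qed.

(** The coefficient of [u_xx] in the transition region is at most the full
    second moment, since [x * s <= s ^ 2] for [s] beyond [x]. *)
Lemma moment1_moment2_le1 x : 0 < x <= delta ->
  0 <= mom 2 0 x + x * mom 1 x delta <= 1.
Proof.
move=> /andP[x0 xd]; rewrite addr_ge0 /=; last 2 first.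
- by rewrite moment2_ge0.
- by rewrite mulr_ge0 ?moment1_ge0 // ltW.
by rewrite -(@moment2_split x) ?(ltW x0) // lerD2l moment1_moment2.
Qed.

End kernel.

(** * Spatial consistency of the separate terms *)

Section spatial_consistency.
Context (R : realType) (gamma : R -> R) (delta K : R) (v v1 v2 : R -> R).
Hypothesis (hdelta : 0 < delta < 1) (hgamma : admissible_kernel gamma delta).
Hypothesis hv : C21 (-1 - delta) 1 K v v1 v2.
Local Notation mu := (@lebesgue_measure R).
Local Notation kd := (kern gamma delta).
Local Notation mom := (moment gamma delta).

(** The kernel is even, so the two halves of the integral combine into the
    second difference, for which the discrete operator is a quadrature. *)
Lemma symmetrized_integral x :
  integrable_on (- delta) delta (fun s => (v (x + s) - v x) * kd s) ->
  integrable_on 0 delta (fun s => (v (x + s) - 2 * v x + v (x - s)) * kd s) /\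
  \int[mu]_(s in `[- delta, delta]) ((v (x + s) - v x) * kd s) =
  \int[mu]_(s in `[0, delta]) ((v (x + s) - 2 * v x + v (x - s)) * kd s).
Proof.
have [d0 d1] := andP hdelta; have K0 := C21_ge0 hv.
set F := fun s => _ => Fi.
have E : (fun s => (v (x + s) - 2 * v x + v (x - s)) * kd s) = (fun s => F s + F (- s)).
  by apply/funext => s; rewrite /F kern_even; ring.
have Fp : integrable_on 0 delta F by apply: (integrable_onS _ _ Fi); lra.
have Fm' : integrable_on (- delta) (- 0) F by apply: (integrable_onS _ _ Fi); lra.
have Fm := integrable_on_opp Fm'.
rewrite E; split; first exact: integrable_onD.
rewrite (@Rintegral_chasles _ _ _ 0) ?oppr_le0 ?ltW //.
rewrite -{1}oppr0 Rintegral_opp // addrC.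
by rewrite RintegralD.
Qed.

Lemma nonlocal_consistency (h : R) (r : nat) x :
  0 <= h -> r%:R * h = delta -> -1 < x <= 0 ->
  integrable_on (- delta) delta (fun s => (v (x + s) - v x) * kd s) ->
  `|\sum_(1 <= j < r.+1)
      (v (x + j%:R * h) - 2 * v x + v (x - j%:R * h)) / (j%:R * h) ^+ 2
      * mom 2 ((j%:R - 1) * h) (j%:R * h)
    - \int[mu]_(s in `[- delta, delta]) ((v (x + s) - v x) * kd s)|
  <= 2 * K * h.
Proof.
have [d0 d1] := andP hdelta; have K0 := C21_ge0 hv.
move=> h0 rh /andP[x1 x0] /symmetrized_integral[Di ->].
have s2i := integrable_sqr_kern d0 hgamma.
have z0 : 0%:R * h = 0 :> R by rewrite mul0r.
pose c j := (v (x + j.+1%:R * h) - 2 * v x + v (x - j.+1%:R * h)) / (j.+1%:R * h) ^+ 2.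
rewrite big_add1 /=.
rewrite (eq_bigr (fun j => c j * \int[mu]_(s in `[j%:R * h, j.+1%:R * h]) (s ^+ 2 * kd s)));
  last by move=> j _; rewrite -[j.+1%:R]natr1 addrK natr1.
have -> : 2 * K * h =
    \int[mu]_(s in `[0%:R * h, r%:R * h]) (2 * K * h * (s ^+ 2 * kd s)).
  by rewrite z0 rh RintegralZl // -/(moment _ _ _ _ _) (kernel_normalized hgamma) mulr1.
have -> : \int[mu]_(s in `[0, delta]) ((v (x + s) - 2 * v x + v (x - s)) * kd s) =
    \int[mu]_(s in `[0%:R * h, r%:R * h]) ((v (x + s) - 2 * v x + v (x - s)) * kd s).
  by rewrite z0 rh.
apply: cellwise_quadrature; rewrite ?z0 ?rh //; first exact: integrable_onZ.
move=> j s /= jr; rewrite in_itv /= => /andP[js sj].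
have jh0 : 0 <= j%:R * h by rewrite mulr_ge0.
have s0 : 0 < s by apply: le_lt_trans js.
have jd : j.+1%:R * h <= delta by rewrite -rh ler_wpM2r // ler_nat.
have sd : s < delta by apply: lt_le_trans jd.
have kd0 : 0 <= kd s by rewrite (kern_ge0 d0 hgamma) // in_itv /= s0.
(* The node of the cell is its right end; at [j = 0] the left end is the
   singular point. *)
have -> : c j * (s ^+ 2 * kd s) - (v (x + s) - 2 * v x + v (x - s)) * kd s =
    (c j - (v (x + s) - 2 * v x + v (x - s)) / s ^+ 2) * (s ^+ 2 * kd s).
  by field; rewrite gt_eqF.
have sk : 0 <= s ^+ 2 * kd s by rewrite mulr_ge0 ?sqr_ge0.
rewrite normrM (ger0_norm sk) ler_wpM2r //.
rewrite (le_trans (C21_second_difference_quotient_lip hv _ _ _)) //; try lra.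
rewrite ler_wpM2l ?mulr_ge0 // lerBlDr; move: js; rewrite -[j.+1%:R]natr1 mulrDl mul1r; lra.
Qed.

(** The difference is [O(s)], and [s * kern s] is integrable off the origin. *)
Lemma integrable_difference_kern x : 0 < x < 1 ->
  integrable_on x delta (fun s => kd s * (v (x - s) - v x)).
Proof.
have [d0 d1] := andP hdelta; have K0 := C21_ge0 hv.
move=> /andP[x0 x1].
have xin : x \in `]-1 - delta, 1[ by rewrite in_itv /=; lra.
pose C := `|v1 x| + `|v2 x| + K.
apply: (@integrable_on_le _ _ _ _ (fun s => C * (s ^+ 1 * kd s))); last first.
- by apply/integrable_onZ/integrable_id_kern.
- move=> s; rewrite in_itv /= => /andP[xs sd].
  have s0 : 0 < s by apply: lt_le_trans xs.
  have sin : x - s \in `[-1 - delta, 1] by rewrite in_itv /=; lra.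
  have C0 : 0 <= C by rewrite !addr_ge0.
  rewrite expr1 !normrM (ger0_norm C0) (gtr0_norm s0) mulrC [leRHS]mulrA.
  apply: ler_wpM2r => //.
  have := C21_taylor hv xin sin.
  rewrite (_ : x - s - x = - s); last by ring.
  rewrite normrN (gtr0_norm s0) => T.
  have -> : v (x - s) - v x = (v (x - s) - v x - - s * v1 x - (- s) ^+ 2 / 2 * v2 x)
      + (- s * v1 x + (- s) ^+ 2 / 2 * v2 x) by ring.
  rewrite (le_trans (ler_normD _ _)) // (le_trans (lerD T (ler_normD _ _))) //.
  have -> : `|- s * v1 x| = s * `|v1 x| by rewrite normrM normrN (gtr0_norm s0).
  have -> : `|(- s) ^+ 2 / 2 * v2 x| = s ^+ 2 / 2 * `|v2 x|.
    by rewrite sqrrN normrM ger0_norm // divr_ge0 ?sqr_ge0.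
  have A1 := normr_ge0 (v1 x). have A2 := normr_ge0 (v2 x).
  have ss : s ^+ 2 <= s by rewrite expr2; nra.
  have sss : s ^+ 3 <= s by rewrite exprS; nra.
  have B1 : K * s ^+ 3 <= K * s by rewrite ler_wpM2l.
  have B2 : s ^+ 2 / 2 * `|v2 x| <= s * `|v2 x| by rewrite ler_wpM2r //; lra.
  by rewrite /C; lra.
- apply: measurable_funM; first by apply: measurable_funTS; exact: measurable_kern.
  apply: measurable_funB => //; apply: subspace_continuous_measurable_fun => //.
  have -> : (fun s => v (x - s)) = (fun s => v (x + s * -1)).
    by apply/funext => s; rewrite mulrN1.
  apply: derivable_within_continuous => s; rewrite in_itv /= => /andP[xs sd].
  have sin : x + s * -1 \in `]-1 - delta, 1[ by rewrite in_itv /=; lra.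
  by case: (is_derive_affine (C21_derive hv sin)).
Qed.

(** The node used on the cell from [(j - 1) * h] to [j * h] is its left end, at
    which the quotient is defined as the first cell starts at [x > 0]. *)
Lemma transition_quadrature (h : R) (m r : nat) x :
  0 < h -> r%:R * h = delta -> (0 < m <= r)%N -> x = m%:R * h ->
  `|\sum_(m.+1 <= j < r.+1)
      (v (x - (j%:R - 1) * h) - v x) / ((j%:R - 1) * h)
      * mom 1 ((j%:R - 1) * h) (j%:R * h)
    - \int[mu]_(s in `[x, delta]) (kd s * (v (x - s) - v x))|
  <= (`|v2 x| * mom 1 x delta + K) * h.
Proof.
have [d0 d1] := andP hdelta; have K0 := C21_ge0 hv.
move=> h0 rh /andP[m0 mr] xE.
have x0 : 0 < x by rewrite xE mulr_gt0 // ltr0n.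
have xd : x <= delta by rewrite xE -rh ler_wpM2r ?ler_nat // ltW.
have i1 := integrable_id_kern d0 hgamma x0.
have i2 : integrable_on x delta (fun s => s ^+ 2 * kd s).
  by apply: integrable_onS (integrable_sqr_kern d0 hgamma) => //; exact: ltW.
pose c j := (v (x - j%:R * h) - v x) / (j%:R * h).
pose H s := (`|v2 x| * h) * (s ^+ 1 * kd s) + (K * h) * (s ^+ 2 * kd s).
have Hi : integrable_on x delta H by apply: integrable_onD; exact: integrable_onZ.
rewrite big_add1 /=.
rewrite (eq_bigr (fun j => c j * \int[mu]_(s in `[j%:R * h, j.+1%:R * h]) (s ^+ 1 * kd s)));
  last by move=> j _; rewrite -[j.+1%:R]natr1 addrK natr1.
apply: (@le_trans _ _ (\int[mu]_(s in `[x, delta]) H s)); last first.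
  rewrite /H RintegralD //; [|exact: integrable_onZ..].
  rewrite !RintegralZl // -!/(moment _ _ _ _ _).
  rewrite mulrDl mulrAC lerD // ler_piMr ?mulr_ge0 ?(ltW h0) //.
  rewrite -(@moment2_split _ _ _ d0 hgamma x) ?(ltW x0) // lerDr.
  by rewrite (moment2_ge0 d0 hgamma).
rewrite -rh xE; apply: cellwise_quadrature; rewrite -?xE ?rh ?(ltW h0) //.
  by apply: integrable_difference_kern; lra.
move=> j s /= /andP[mj jr]; rewrite in_itv /= => /andP[js sj].
have jh0 : 0 < j%:R * h by rewrite mulr_gt0 // ltr0n (leq_trans m0).
have s0 : 0 < s by apply: lt_trans js.
have jd : j.+1%:R * h <= delta by rewrite -rh ler_wpM2r ?(ltW h0) // ler_nat.
have sd : s < delta by apply: lt_le_trans jd.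
have kd0 : 0 <= kd s by rewrite (kern_ge0 d0 hgamma) // in_itv /= s0.
have -> : c j * (s ^+ 1 * kd s) - kd s * (v (x - s) - v x) =
    - ((v (x - s) - v x) / s - c j) * (s ^+ 1 * kd s).
  by field; rewrite gt_eqF.
have sk : 0 <= s ^+ 1 * kd s by rewrite mulr_ge0 // ltW.
have -> : H s = (`|v2 x| + K * s) * h * (s ^+ 1 * kd s) by rewrite /H; ring.
rewrite normrM normrN (ger0_norm sk) ler_wpM2r //.
rewrite (le_trans (C21_difference_quotient_lip hv _ _ _)) //; try lra.
rewrite ler_wpM2l ?addr_ge0 ?mulr_ge0 ?(ltW s0) //.
move: sj; rewrite -[j.+1%:R]natr1 mulrDl mul1r; lra.
Qed.

Lemma second_difference_consistency x h : 0 < h ->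
  -1 - delta <= x - h -> x + h <= 1 ->
  `|(v (x + h) - 2 * v x + v (x - h)) / h ^+ 2 - v2 x| <= 2 * K * h.
Proof.
have [d0 d1] := andP hdelta; have K0 := C21_ge0 hv.
move=> h0 xm xp.
have := @C21_second_difference _ _ _ _ _ _ _ hv x h.
rewrite !in_itv /= => /(_ ltac:(lra) ltac:(lra) ltac:(lra)) T.
have h2 : 0 < h ^+ 2 by rewrite exprn_gt0.
rewrite -(ler_pM2l h2) -{1}(gtr0_norm h2) -normrM mulrBr mulrCA divff ?gt_eqF //.
rewrite mulr1 (le_trans T) // (gtr0_norm h0) exprS; lra.
Qed.

Lemma forward_difference_consistency x h : 0 < h <= 1 ->
  -1 - delta < x -> x + h <= 1 ->
  `|(v (x + h) - v x) / h - v1 x| <= `|v2 x| * h + K * h ^+ 2.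
Proof.
have [d0 d1] := andP hdelta; have K0 := C21_ge0 hv.
move=> /andP[h0 h1] xm xp.
have := @C21_taylor _ _ _ _ _ _ _ hv x (x + h).
rewrite !in_itv /= => /(_ ltac:(lra) ltac:(lra)).
rewrite (_ : x + h - x = h) ?(gtr0_norm h0); last by ring.
move=> T; rewrite -(ler_pM2l h0) -{1}(gtr0_norm h0) -normrM mulrBr mulrCA divff ?gt_eqF // mulr1.
have -> : v (x + h) - v x - h * v1 x =
  (v (x + h) - v x - h * v1 x - h ^+ 2 / 2 * v2 x) + h ^+ 2 / 2 * v2 x by ring.
rewrite (le_trans (ler_normD _ _)) // normrM (ger0_norm (_ : 0 <= h ^+ 2 / 2)); last first.
  by rewrite divr_ge0 ?sqr_ge0.
have A := normr_ge0 (v2 x).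
have h2 : 0 < h ^+ 2 by rewrite exprn_gt0.
have -> : h * (`|v2 x| * h + K * h ^+ 2) = h ^+ 2 * `|v2 x| + K * h ^+ 3 by ring.
nra.
Qed.

End spatial_consistency.

(** * Spatial consistency of the quasi-nonlocal operator *)

(** Two of the three errors contain [h * |v2 x|] times the first moment, namely
    the quadrature and the forward difference; everything else is [O(K * h)]
    because [h <= x] turns the first moment into a second one. *)
Lemma transition_consistency (R : realType) (gamma : R -> R) (delta K : R) (v v1 v2 : R -> R)
    (h C0 : R) (m r : nat) x :
  0 < delta < 1 -> admissible_kernel gamma delta ->
  C21 (-1 - delta) 1 K v v1 v2 ->
  0 < h -> r%:R * h = delta -> (0 < m <= r)%N -> x = m%:R * h -> x + h <= 1 ->
  `|v2 x| * moment gamma delta 1 x delta <= C0 ->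
  `|\sum_(m.+1 <= j < r.+1)
      (v (x - (j%:R - 1) * h) - v x) / ((j%:R - 1) * h)
      * moment gamma delta 1 ((j%:R - 1) * h) (j%:R * h)
    + moment gamma delta 1 x delta * ((v (x + h) - v x) / h)
    + (moment gamma delta 2 0 x + x * moment gamma delta 1 x delta)
      * ((v (x + h) - 2 * v x + v (x - h)) / h ^+ 2)
    - (\int[lebesgue_measure]_(s in `[x, delta])
         (kern gamma delta s * (v (x - s) - v x))
       + moment gamma delta 1 x delta * v1 x
       + (moment gamma delta 2 0 x + x * moment gamma delta 1 x delta) * v2 x)|
  <= (2 * C0 + 4 * K) * h.
Proof.
move=> hdelta hgamma hv h0 rh m0r xE xh1 vC.
have [d0 d1] := andP hdelta; have K0 := C21_ge0 hv.
have hx : h <= x.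
  by rewrite xE ler_peMl ?(ltW h0) // ler1n; case/andP: m0r.
have x0 : 0 < x by lra.
have xd : x <= delta.
  by rewrite xE -rh ler_wpM2r ?(ltW h0) // ler_nat; case/andP: m0r.
have m1 := moment1_ge0 d0 hgamma x0.
have /andP[c0 c1] := moment1_moment2_le1 d0 hgamma (introT andP (conj x0 xd)).
have A := transition_quadrature hdelta hgamma hv h0 rh m0r xE.
have h01 : 0 < h <= 1 by lra.
have ax : -1 - delta < x by lra.
have axh : -1 - delta <= x - h by lra.
have B := forward_difference_consistency hdelta hv h01 ax xh1.
have C := second_difference_consistency hdelta hv h0 axh xh1.
have m2 := moment2_ge0 d0 hgamma (lexx 0) xd.
move: A B C m1 m2 c0 c1 vC.
set S := \sum_(_ <= _ < _) _; set I := Rintegral _ _ _.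
set M1 := moment _ _ 1 _ _; set M2 := moment _ _ 2 _ _.
set G := (v (x + h) - v x) / h; set D := _ / h ^+ 2.
move=> A B C m1 m2 c0 c1 vC.
have -> : S + M1 * G + (M2 + x * M1) * D - (I + M1 * v1 x + (M2 + x * M1) * v2 x) =
  (S - I) + (M1 * (G - v1 x) + (M2 + x * M1) * (D - v2 x)) by ring.
rewrite (le_trans (ler_normD _ _)) // (le_trans (lerD A (ler_normD _ _))) //.
rewrite !normrM (ger0_norm m1) (ger0_norm c0).
have B' : M1 * `|G - v1 x| <= C0 * h + K * h.
  apply: (le_trans (ler_wpM2l m1 B)).
  have hM : h * M1 <= 1 by apply: le_trans c1; rewrite ler_wpDl // ler_wpM2r.
  have -> : M1 * (`|v2 x| * h + K * h ^+ 2) = (`|v2 x| * M1) * h + (K * h) * (h * M1) by ring.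
  by rewrite lerD // ?ler_wpM2r ?(ltW h0) // ler_piMr // mulr_ge0 // ltW.
have C' : (M2 + x * M1) * `|D - v2 x| <= 2 * K * h.
  by apply: (le_trans (ler_wpM2l c0 C)); rewrite ler_piMl // !mulr_ge0 // ltW.
have A' : (`|v2 x| * M1 + K) * h <= (C0 + K) * h by rewrite ler_wpM2r ?(ltW h0) // lerD2r.
lra.
Qed.

Lemma gridxD (R : realType) (N : nat) (i j : int) :
  gridx R N (i + j) = gridx R N i + j%:~R * N%:R^-1.
Proof. by rewrite /gridx intrD mulrDl addrA. Qed.

Lemma gridx_le (R : realType) (N : nat) (i j : int) : (0 < N)%N ->
  (gridx R N i <= gridx R N j) = (i <= j).
Proof.
by move=> N0; rewrite /gridx lerD2l ler_pM2r ?invr_gt0 ?ltr0n // ler_int.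
Qed.

Lemma gridx_lt (R : realType) (N : nat) (i j : int) : (0 < N)%N ->
  (gridx R N i < gridx R N j) = (i < j).
Proof.
by move=> N0; rewrite /gridx ltrD2l ltr_pM2r ?invr_gt0 ?ltr0n // ltr_int.
Qed.

Lemma gridx_interface (R : realType) (N m : nat) : (0 < N)%N ->
  gridx R N (N + m)%N%:Z = m%:R * N%:R^-1.
Proof.
move=> N0; rewrite /gridx -pmulrn natrD mulrDl divff ?pnatr_eq0 -?lt0n //.
by rewrite addrA addNr add0r.
Qed.

Lemma gridx_interior (R : realType) (N : nat) (i : int) :
  (0 < N)%N -> interior_index N i -> -1 < gridx R N i < 1.
Proof.
move=> N0 /andP[i1 i2].
have lo : gridx R N 0 = -1 by rewrite /gridx mul0r addr0.
have hi : gridx R N (N + N)%N%:Z = 1.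
  by rewrite gridx_interface // divff // pnatr_eq0; lia.
by apply/andP; split; [rewrite -lo|rewrite -hi]; rewrite gridx_lt //; lia.
Qed.

(** The nodes that carry a value: the interior ones together with the nonlocal
    layer on the left and the single boundary node on the right. *)
Definition grid_index (N r : nat) (j : int) : bool := - (r%:Z - 1) <= j <= (2 * N)%N%:Z.

Lemma gridx_bounds (R : realType) (delta : R) (N r : nat) (j : int) :
  (0 < N)%N -> delta = r%:R * N%:R^-1 -> grid_index N r j ->
  -1 - delta <= gridx R N j <= 1.
Proof.
move=> N0 dE /andP[j1 j2].
have lo : gridx R N (- r%:Z) = -1 - delta.
  by rewrite /gridx dE mulrNz mulNr -pmulrn.
have hi : gridx R N (2 * N)%N%:Z = 1.
  rewrite mul2n -addnn gridx_interface // divff // pnatr_eq0; lia.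
by apply/andP; split; [rewrite -lo|rewrite -hi]; rewrite gridx_le //; lia.
Qed.

Lemma grid_index_neighbours (N r : nat) (i : int) : (0 < r)%N -> interior_index N i ->
  [/\ grid_index N r i, grid_index N r (i + 1) & grid_index N r (i - 1)].
Proof. by rewrite /grid_index => r0 /andP[i1 i2]; split; lia. Qed.

Lemma grid_index_nonlocal (N r j : nat) (i : int) : (r < N)%N -> (j <= r)%N ->
  1 <= i <= N%:Z -> grid_index N r (i + j%:Z) /\ grid_index N r (i - j%:Z).
Proof. by rewrite /grid_index => rN jr /andP[i1 i2]; split; lia. Qed.

(** The left nodes of the transition stencil stay in the grid, unlike the right
    ones. *)
Lemma grid_index_transition (N r m j : nat) : (m <= r < N)%N -> (m < j <= r)%N ->
  grid_index N r ((N + m)%N%:Z - j%:Z + 1).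
Proof. by rewrite /grid_index => /andP[mr rN] /andP[mj jr]; lia. Qed.

Lemma grid_index_cases (N r : nat) (j : int) :
  grid_index N r j -> interior_index N j \/ boundary_index N r j.
Proof.
rewrite /interior_index /boundary_index => /andP[j1 j2].
have [?|?] := leP j 0; first by right; left; apply/andP; split; lia.
have [?|?] := eqVneq j (2 * N)%N%:Z; first by right; right.
by left; apply/andP; split; lia.
Qed.

Lemma interface_offset (N : nat) (i : int) : N%:Z < i ->
  exists2 m, (0 < m)%N & i = (N + m)%N%:Z.
Proof. by move=> Ni; exists `|i - N%:Z|%N; lia. Qed.

(** The values at [i + j - 1] cancel between the two sums. This matters because
    that index can exceed the last node, where the grid function is
    arbitrary. *)
Lemma Lqnlh_transitionE (R : realType) (gamma : R -> R) (N r m : nat) (w : int -> R) :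
  (0 < N)%N -> (0 < m <= r)%N ->
  let h : R := N%:R^-1 in let delta := r%:R * h in let x := m%:R * h in
  let i := (N + m)%N%:Z in
  Lqnlh gamma N r w i =
    \sum_(m.+1 <= j < r.+1)
      (w (i - j%:Z + 1) - w i) / ((j%:R - 1) * h)
      * moment gamma delta 1 ((j%:R - 1) * h) (j%:R * h)
    + moment gamma delta 1 x delta * ((w (i + 1) - w i) / h)
    + (moment gamma delta 2 0 x + x * moment gamma delta 1 x delta)
      * ((w (i + 1) - 2 * w i + w (i - 1)) / h ^+ 2).
Proof.
move=> N0 /andP[m0 mr] h delta x i.
rewrite /Lqnlh -/h -/delta gridx_interface // -/x.
have -> : (i <= N%:Z) = false by rewrite /i; lia.
have -> : (i <= (N + r)%N%:Z) by rewrite /i; lia.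
have -> : `|i - N%:Z|%N = m by rewrite /i; lia.
congr (_ + _ + _); rewrite -sumrB; apply: eq_bigr => j _.
rewrite -mulrBl; congr (_ * _).
rewrite -[2 * (_ - _) * h]mulrA (invfM 2) mulrA mulrA -mulrBl; congr (_ * _).
by field.
Qed.

Lemma Lqnlh_consistency (R : realType) (gamma : R -> R) (delta K C0 t : R) (N r : nat)
    (u : R -> R -> R) (w : int -> R) (i : int) :
  0 < delta < 1 -> admissible_kernel gamma delta ->
  C21 (-1 - delta) 1 K (fun x => u x t) (fun x => dx u x t) (fun x => dx (dx u) x t) ->
  (0 < N)%N -> delta = r%:R * N%:R^-1 -> interior_index N i ->
  (forall j, grid_index N r j -> w j = u (gridx R N j) t) ->
  (forall x, -1 < x <= 0 ->
     integrable_on (- delta) delta (fun s => (u (x + s) t - u x t) * kern gamma delta s)) ->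
  0 <= C0 ->
  (forall x, 0 < x <= delta -> `|dx (dx u) x t| * moment gamma delta 1 x delta <= C0) ->
  `|Lqnlh gamma N r w i - Lqnl gamma delta u (gridx R N i) t| <= (2 * C0 + 4 * K) * N%:R^-1.
Proof.
move=> hdelta hgamma hv N0 dE iI wu ki C00 vC.
have [d0 d1] := andP hdelta; have K0 := C21_ge0 hv.
pose h : R := N%:R^-1.
have h0 : 0 < h by rewrite invr_gt0 ltr0n.
have hN : N%:R * h = 1 by rewrite divff // pnatr_eq0 -lt0n.
have rN : (r < N)%N.
  by rewrite -(ltr_nat R) -(ltr_pM2r h0) hN -dE.
have r0 : (0 < r)%N.
  by rewrite -(ltr_nat R) -(ltr_pM2r h0) mul0r -dE.
have weak : 2 * K * h <= (2 * C0 + 4 * K) * h by rewrite ler_wpM2r ?(ltW h0) //; lra.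
have /andP[x1 x_1] := gridx_interior R N0 iI.
have [gi gp gm] := grid_index_neighbours r0 iI.
have [iN|Ni] := leP i N%:Z.
  have x0 : gridx R N i <= 0.
    by rewrite -(mul0r h) -(gridx_interface R 0 N0) addn0 gridx_le.
  rewrite /Lqnlh /Lqnl iN x0 -dE -/h.
  apply: le_trans weak.
  have x01 : -1 < gridx R N i <= 0 by rewrite x1.
  have := nonlocal_consistency hdelta hgamma hv (ltW h0) (esym dE) x01 (ki _ x01).
  congr (`|_ - _| <= _); apply: eq_big_nat => j /andP[j0 jr].
  have [gpj gmj] := grid_index_nonlocal rN jr (introT andP (conj (proj1 (andP iI)) iN)).
  by rewrite (wu _ gi) (wu _ gpj) (wu _ gmj) !gridxD mulrNz mulNr.
have [m m0 iE] := interface_offset Ni.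
have xE : gridx R N i = m%:R * h by rewrite iE gridx_interface.
have x0 : 0 < m%:R * h by rewrite mulr_gt0 // ltr0n.
have xp : gridx R N (i + 1) = m%:R * h + h by rewrite gridxD xE mul1r.
have xm : gridx R N (i - 1) = m%:R * h - h by rewrite gridxD xE mulN1r.
have xp1 : m%:R * h + h <= 1.
  by rewrite -xp; have /andP[_] := gridx_bounds N0 dE gp.
have xm1 : -1 - delta <= m%:R * h - h.
  have : 0 <= m%:R * h - h by rewrite subr_ge0 ler_peMl ?(ltW h0) // ler1n.
  lra.
have [mr|rm] := leqP m r.
  have xd : m%:R * h <= delta by rewrite dE ler_wpM2r ?(ltW h0) // ler_nat.
  rewrite {1}iE Lqnlh_transitionE ?m0 // -iE -/h -dE.
  rewrite /Lqnl xE (lt_geF x0) xd.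
  have x0d : 0 < m%:R * h <= delta by rewrite x0.
  have := transition_consistency hdelta hgamma hv h0 (esym dE)
    (introT andP (conj m0 mr)) erefl xp1 (vC _ x0d).
  congr (`|_ - _| <= _).
  rewrite (wu _ gi) (wu _ gp) (wu _ gm) xE xp xm.
  congr (_ + _ + _); apply: eq_big_nat => j /andP[j0 jr].
  have gj : grid_index N r (i - j%:Z + 1).
    by rewrite iE grid_index_transition ?mr ?rN ?j0.
  rewrite (wu _ gj).
  rewrite -addrA gridxD xE; congr ((u _ t - _) / _ * _).
  by rewrite intrD mulrNz mulr1z -pmulrn -/h; ring.
have dx0 : delta < m%:R * h by rewrite dE ltr_pM2r // ltr_nat.
rewrite /Lqnlh /Lqnl xE (lt_geF x0) (lt_geF dx0).
have NrI : (N + r)%N%:Z < i by rewrite iE ltz_nat ltn_add2l.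
rewrite (lt_geF Ni) (lt_geF NrI) (wu _ gi) (wu _ gp) (wu _ gm) xE xp xm.
apply: le_trans weak.
exact: (second_difference_consistency hdelta hv h0 xm1 xp1).
Qed.

(** * Curvature against the first moment near the interface *)

(** To first order, the integrand of the nonlocal operator is [v1 x * s] times
    the kernel, and the remainder is integrable because it is [O(s ^ 2)]. *)
Lemma integrable_first_moment (R : realType) (gamma : R -> R) (delta K : R)
    (v v1 v2 : R -> R) x :
  0 < delta < 1 -> admissible_kernel gamma delta ->
  C21 (-1 - delta) 1 K v v1 v2 -> -1 < x <= 0 -> v1 x != 0 ->
  integrable_on (- delta) delta (fun s => (v (x + s) - v x) * kern gamma delta s) ->
  integrable_on 0 delta (fun s => s ^+ 1 * kern gamma delta s).
Proof.
move=> hdelta hgamma hv /andP[x1 x0] v1x Fi.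
have [d0 d1] := andP hdelta; have K0 := C21_ge0 hv.
pose kd := kern gamma delta.
pose F s := (v (x + s) - v x) * kd s.
have {}Fi : integrable_on 0 delta F by apply: (integrable_onS _ _ Fi); lra.
have Gi := integrable_onZ (`|v2 x| + K) (integrable_sqr_kern d0 hgamma).
have FGi := integrable_onD (integrable_norm Fi) (integrable_norm Gi).
apply: (integrable_on_le _ _ (integrable_onZ `|v1 x|^-1 FGi)).
  exact: measurable_pow_kern.
move=> s; rewrite in_itv /= => /andP[s0 sd].
rewrite [leRHS]normrM normfV normr_id ler_pdivlMl ?normr_gt0 //.
rewrite [leRHS]ger0_norm ?addr_ge0 // expr1 -/kd.
have C0 : 0 <= (`|v2 x| + K) * s ^+ 2 by rewrite mulr_ge0 ?addr_ge0 ?sqr_ge0.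
have -> : `|(`|v2 x| + K) * (s ^+ 2 * kd s)| = (`|v2 x| + K) * s ^+ 2 * `|kd s|.
  by rewrite mulrA normrM ger0_norm.
rewrite [`|F s|]normrM [`|s * _|]normrM (ger0_norm s0) mulrA -mulrDl ler_wpM2r //.
have xin : x \in `]-1 - delta, 1[ by rewrite in_itv /=; lra.
have sin : x + s \in `[-1 - delta, 1] by rewrite in_itv /=; lra.
have := C21_taylor hv xin sin; rewrite (_ : x + s - x = s); last by ring.
rewrite (ger0_norm s0) => T.
have -> : `|v1 x| * s = `|s * v1 x| by rewrite normrM (ger0_norm s0) mulrC.
have -> : s * v1 x = (v (x + s) - v x) - s ^+ 2 / 2 * v2 x
   - (v (x + s) - v x - s * v1 x - s ^+ 2 / 2 * v2 x) by ring.
rewrite (le_trans (ler_normB _ _)) // (le_trans (lerD (ler_normB _ _) T)) // -addrA lerD2l.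
rewrite normrM ger0_norm ?divr_ge0 ?sqr_ge0 //.
have sss : s ^+ 3 <= s ^+ 2 by rewrite !exprS; nra.
have : K * s ^+ 3 <= K * s ^+ 2 by rewrite ler_wpM2l.
have : s ^+ 2 / 2 * `|v2 x| <= s ^+ 2 * `|v2 x|.
  by rewrite ler_wpM2r // ler_pdivrMr // ler_peMr ?sqr_ge0 // ler1n.
lra.
Qed.

(** By the mean value theorem [v2] has zeros arbitrarily close to [0] on the
    left. *)
Lemma second_derivative_at_interface (R : realType) (delta K : R) (v v1 v2 : R -> R) x :
  0 < delta -> C21 (-1 - delta) 1 K v v1 v2 ->
  (forall y, -1 < y <= 0 -> v1 y = 0) -> 0 < x < 1 -> `|v2 x| <= K * x.
Proof.
move=> d0 hv v10 /andP[x0 x1]; have K0 := C21_ge0 hv.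
apply/ler_addgt0Pr => e e0.
pose y := Num.min (1 / 2) (e / (K + 1)).
have y0 : 0 < y by rewrite lt_min !divr_gt0 // ltr_wpDl.
have y1 : y <= 1 / 2 by rewrite ge_min lexx.
have ye : K * y <= e.
  have : y <= e / (K + 1) by rewrite ge_min lexx orbT.
  by rewrite ler_pdivlMr ?ltr_wpDl //; lra.
have in0 : 0 \in `]-1 - delta, 1[ by rewrite in_itv /=; lra.
have iny : - y \in `]-1 - delta, 1[ by rewrite in_itv /=; lra.
have inx : x \in `]-1 - delta, 1[ by rewrite in_itv /=; lra.
have [c cin [c0 _ /eqP]] := MVT_open (C21_derive2 hv) in0 iny.
rewrite !v10 ?subrr ?subr0 1?eq_sym ?mulf_eq0 ?oppr_eq0 ?(gt_eqF y0) ?orbF; try lra.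
move=> /eqP c20; have := C21_lip hv inx cin; rewrite c20 subr0 => /le_trans; apply.
move: c0; rewrite !subr0 normrN (gtr0_norm y0) => c0.
rewrite (le_trans (ler_wpM2l K0 (ler_normB _ _))) // (gtr0_norm x0) mulrDr lerD2l.
by rewrite (le_trans _ ye) // ler_wpM2l.
Qed.

(** The family is indexed by time, and the bound has to be uniform in it. The
    dichotomy is on the kernel alone: it is decided once for all times. *)
Lemma second_derivative_moment_bound (R : realType) (gamma : R -> R) (delta K M : R)
    (I : Type) (v v1 v2 : I -> R -> R) :
  0 < delta < 1 -> admissible_kernel gamma delta -> 0 <= K -> 0 <= M ->
  (forall i, C21 (-1 - delta) 1 K (v i) (v1 i) (v2 i)) ->
  (forall i x, x \in `]-1 - delta, 1[ -> `|v2 i x| <= M) ->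
  (forall i x, -1 < x <= 0 ->
     integrable_on (- delta) delta (fun s => (v i (x + s) - v i x) * kern gamma delta s)) ->
  exists2 C0, 0 <= C0 & forall i x, 0 < x <= delta ->
    `|v2 i x| * moment gamma delta 1 x delta <= C0.
Proof.
move=> hdelta hgamma K0 M0 hv vM ki.
have [d0 d1] := andP hdelta.
(* Regular kernels: the first moment is finite. Singular kernels: the slope
   vanishes on the nonlocal side. *)
have [i1|ni1] := pselect (integrable_on 0 delta (fun s => s ^+ 1 * kern gamma delta s)).
  exists (M * moment gamma delta 1 0 delta).
    by rewrite mulr_ge0 // (moment_ge0 d0 hgamma).
  move=> i x /andP[x0 xd]; apply: ler_pM => //; first exact: moment1_ge0.
    by apply: vM; rewrite in_itv /=; lra.
  rewrite /moment (@Rintegral_chasles _ 0 delta x) ?(ltW x0) // lerDr.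
  apply: (moment_ge0 d0 hgamma) => //.
  by apply: (integrable_onS _ _ i1).
exists K => // i x /andP[x0 xd].
have v2x : `|v2 i x| <= K * x.
  apply: (second_derivative_at_interface d0 (hv i)); last by lra.
  move=> y y1; apply/eqP/negPn/negP => v1y; apply: ni1.
  exact: (integrable_first_moment hdelta hgamma (hv i) y1 v1y (ki i y y1)).
have m1 := moment1_ge0 d0 hgamma x0.
apply: (le_trans (ler_wpM2r m1 v2x)); rewrite -mulrA ler_piMr //.
have /andP[_] := moment1_moment2_le1 d0 hgamma (introT andP (conj x0 xd)).
by apply: le_trans; rewrite lerDr moment2_ge0.
Qed.

(** * Slices, passage to the limit and Taylor expansion in time *)

Lemma within_continuous_precomp (T U V : topologicalType) (A : set T) (B : set U)
    (phi : U -> T) (f : T -> V) :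
  continuous phi -> (forall y, B y -> A (phi y)) ->
  {within A, continuous f} -> {within B, continuous (fun y => f (phi y))}.
Proof.
move=> cphi BA cf; rewrite continuous_subspace_in => y /set_mem By.
move=> P nP; change (nbhs_subspace (y : subspace B) ((fun y => f (phi y)) @^-1` P)).
rewrite -(nbhs_subspace_in By).
have := cf (phi y) P nP.
change (nbhs_subspace (phi y : subspace A) (f @^-1` P) ->
  within B (nbhs y) ((fun y => f (phi y)) @^-1` P)).
rewrite -(nbhs_subspace_in (BA _ By)) => /cphi H.
have {}H : nbhs y (phi @^-1` [set z | A z -> P (f z)]) := H.
change (nbhs y [set z | B z -> P (f (phi z))]).
by apply: filterS H => z Pz Bz; exact: (Pz (BA _ Bz)).
Qed.

Lemma continuous_slice_left (R : realType) (t : R) : continuous (fun x : R => (x, t)).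
Proof.
move=> x P [[A B] [/= nA nB] AB]; apply: filterS nA => y Ay.
by apply: AB; split=> //; exact: nbhs_singleton.
Qed.

Lemma continuous_slice_right (R : realType) (x : R) : continuous (fun t : R => (x, t)).
Proof.
move=> t P [[A B] [/= nA nB] AB]; apply: filterS nB => y By.
by apply: AB; split=> //; exact: nbhs_singleton.
Qed.

(** A continuous function is bounded on the compact closed rectangle. *)
Lemma extends_cont_bounded (R : realType) (a b c d : R) (v : R -> R -> R) :
  extends_cont a b c d v -> exists2 M, 0 <= M &
    forall x t, x \in `]a, b[ -> t \in `]c, d[ -> `|v x t| <= M.
Proof.
move=> [g cg vg].
have cpt : compact (`[a, b] `*` `[c, d] : set (R * R)).
  by apply: compact_setX; exact: segment_compact.
have [M [_ gM]] := compact_bounded (continuous_compact cg cpt).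
have M1 : M < `|M| + 1 by rewrite (le_lt_trans (ler_norm M)) // ltrDl.
exists (`|M| + 1); first by rewrite addr_ge0.
move=> x t xab tcd; rewrite vg //; apply: (gM _ M1).
exists (x, t) => //=; split; exact: subset_itv_oo_cc.
Qed.

(** In the transition region this rests on the cancelled form of the operator,
    as convergence is known only at the nodes of the grid. *)
Lemma Lqnlh_cvg (R : realType) (gamma : R -> R) (N r : nat) (T : Type)
    (F : set_system T) (wt : T -> int -> R) (w : int -> R) (i : int) :
  Filter F -> (0 < r < N)%N -> interior_index N i ->
  (forall j, grid_index N r j -> wt t j @[t --> F] --> w j) ->
  Lqnlh gamma N r (wt t) i @[t --> F] --> Lqnlh gamma N r w i.
Proof.
move=> FF /andP[r0 rN] iI cw.
have [gi gp gm] := grid_index_neighbours r0 iI.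
have csum (a b : nat) (G : T -> nat -> R) (G0 : nat -> R) :
    (forall j, (a <= j < b)%N -> G t j @[t --> F] --> G0 j) ->
    \sum_(a <= j < b) G t j @[t --> F] --> \sum_(a <= j < b) G0 j.
  move=> cG; rewrite big_nat; under eq_fun do rewrite big_nat.
  by apply: cvg_big => //; exact: add_continuous.
have cdiff2 j k : grid_index N r j -> grid_index N r k ->
    wt t j - 2 * wt t i + wt t k @[t --> F] --> w j - 2 * w i + w k.
  move=> gj gk; apply: cvgD (cw _ gk); apply: cvgB (cw _ gj) _.
  by apply: cvgM (cw _ gi); exact: cvg_cst.
have [iN|Ni] := leP i N%:Z.
  rewrite /Lqnlh iN; apply: csum => j /andP[j1 jr].
  apply: cvgM; last exact: cvg_cst.
  apply: cvgM; last exact: cvg_cst.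
  have [] := grid_index_nonlocal rN jr (introT andP (conj (proj1 (andP iI)) iN)).
  exact: cdiff2.
have [m m0 iE] := interface_offset Ni.
have N0 : (0 < N)%N by apply: leq_ltn_trans rN.
have [mr|rm] := leqP m r.
  rewrite iE; under eq_fun do rewrite Lqnlh_transitionE ?m0 //.
  rewrite Lqnlh_transitionE ?m0 // -iE.
  apply: cvgD; first apply: cvgD.
  - apply: csum => j /andP[j1 jr].
    apply: cvgM; last exact: cvg_cst.
    apply: cvgM; last exact: cvg_cst.
    apply: cvgB; apply: cw => //.
    by rewrite iE grid_index_transition ?mr ?rN ?j1.
  - apply: cvgM; first exact: cvg_cst.
    by apply: cvgM; [apply: cvgB; exact: cw|exact: cvg_cst].
  - apply: cvgM; first exact: cvg_cst.
    by apply: cvgM; [exact: cdiff2|exact: cvg_cst].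
have NrI : (N + r)%N%:Z < i by rewrite iE ltz_nat ltn_add2l.
rewrite /Lqnlh (lt_geF Ni) (lt_geF NrI).
by apply: cvgM; [exact: cdiff2|exact: cvg_cst].
Qed.

Lemma time_taylor (R : realType) (T M : R) (f f1 f2 : R -> R) t t' :
  {within `[0, T], continuous f} ->
  (forall s, s \in `]0, T[ -> is_derive s (1 : R) f (f1 s)) ->
  (forall s, s \in `]0, T[ -> is_derive s (1 : R) f1 (f2 s)) ->
  (forall s, s \in `]0, T[ -> `|f2 s| <= M) ->
  t \in `]0, T[ -> t' \in `[0, T] ->
  `|f t' - f t - (t' - t) * f1 t| <= M * `|t' - t| ^+ 2.
Proof.
move=> cf d1 d2 f2M tT t'T.
have [c cT [ct ->]] := MVT_closed d1 cf tT t'T.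
have [d dT [_ _ E]] := MVT_open d2 tT cT.
rewrite (mulrC (t' - t)) -mulrBl E !normrM expr2 mulrA.
by rewrite ler_wpM2r // ler_pM // f2M.
Qed.

(** * The error of one time step *)

Lemma Ck_closed_rect_slices (R : realType) (k : nat) (a b c d : R) (u : R -> R -> R) :
  Ck_closed_rect k a b c d u ->
  (forall t, t \in `[c, d] -> {within `[a, b], continuous (fun x => u x t)}) /\
  (forall x, x \in `[a, b] -> {within `[c, d], continuous (fun t => u x t)}).
Proof.
move=> [cu _]; split=> z zin.
- apply: (@within_continuous_precomp _ _ _ _ _ (fun x => (x, z)) _ _ _ cu) => //.
  exact: continuous_slice_left.
- apply: (@within_continuous_precomp _ _ _ _ _ (fun t => (z, t)) _ _ _ cu) => //.
  exact: continuous_slice_right.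
Qed.

Lemma derivable_is_derive1 (R : realType) (f : R -> R) x :
  derivable f x 1 -> is_derive x (1 : R) f (derive1 f x).
Proof. by move=> df; rewrite derive1E; exact: DeriveDef. Qed.

(** The starting time is positive, so that the equation holds there, and the step
    has any length: the case of a step starting at time [0] is a limit of this
    one. *)
Lemma local_truncation_error (R : realType) (gamma : R -> R) (delta T : R)
    (f : R -> R -> R) (u0 : R -> R) (u : R -> R -> R) :
  0 < delta < 1 -> admissible_kernel gamma delta ->
  strong_solution gamma delta T f u0 u ->
  Ck_closed_rect 2 (-1 - delta) 1 0 T u ->
  (exists K : R, forall t, t \in `]0, T[ ->
       K.-lipschitz_(`]-1 - delta, 1[) (fun x => dx (dx u) x t)) ->
  exists2 C : R, 0 <= C & forall N r : nat, (0 < N)%N -> delta = r%:R * N%:R^-1 ->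
    forall (i : int) (w : int -> R) t t', interior_index N i ->
    t \in `]0, T[ -> t <= t' <= T ->
    (forall j, grid_index N r j -> w j = u (gridx R N j) t) ->
    `|u (gridx R N i) t' - u (gridx R N i) t
      - (t' - t) * (Lqnlh gamma N r w i + f (gridx R N i) t)|
    <= C * (t' - t) * (N%:R^-1 + (t' - t)).
Proof.
move=> hdelta hgamma hsol hC2 [K hK]; have [d0 d1] := andP hdelta.
have [cx ct] := Ck_closed_rect_slices hC2.
have [_ [_ [du [_ [ddx [bxx _] _]] [_ [ddt _ [btt _]]]]]] := hC2.
have [M1 M10 M1P] := extends_cont_bounded bxx.
have [M2 M20 M2P] := extends_cont_bounded btt.
have K0 : 0 <= `|K| by [].
have hv t : t \in `]0, T[ ->
    C21 (-1 - delta) 1 `|K| (fun x => u x t) (fun x => dx u x t) (fun x => dx (dx u) x t).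
  move=> tT; apply: MkC21.
  - exact: normr_ge0.
  - exact/cx/subset_itv_oo_cc.
  - by move=> x xd; have [d _] := du _ _ xd tT; exact: (derivable_is_derive1 d).
  - by move=> x xd; have [d _] := ddx _ _ xd tT; exact: (derivable_is_derive1 d).
  - move=> x y xd yd; apply: (le_trans (hK t tT (x, y) (conj xd yd))) => /=.
    by rewrite ler_wpM2r // ler_norm.
have ki t : t \in `]0, T[ -> forall x, -1 < x <= 0 ->
    integrable_on (- delta) delta (fun s => (u (x + s) t - u x t) * kern gamma delta s).
  by move=> tT x x1; apply: (sol_integrable hsol).
have [C0 C00 C0P] := @second_derivative_moment_bound R gamma delta `|K| M1
   {t : R | t \in `]0, T[} (fun t x => u x (sval t)) (fun t x => dx u x (sval t))
   (fun t x => dx (dx u) x (sval t)) hdelta hgamma K0 M10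
   (fun t => hv _ (svalP t)) (fun t x xd => M1P _ _ xd (svalP t)) (fun t => ki _ (svalP t)).
pose C1 := 2 * C0 + 4 * `|K|.
have C10 : 0 <= C1 by rewrite addr_ge0 ?mulr_ge0.
exists (C1 + M2); first by rewrite addr_ge0.
move=> N r N0 dE i w t t' iI tT /andP[tt' t'T] wu.
set x := gridx R N i.
have t0T := tT; rewrite in_itv /= in t0T; case/andP: t0T => t0 tT'.
have xin : -1 < x < 1 by exact: gridx_interior.
have xd : x \in `]-1 - delta, 1[ by rewrite in_itv /=; lra.
have sp := Lqnlh_consistency hdelta hgamma (hv _ tT) N0 dE iI wu (ki _ tT) C00
  (C0P (exist _ t tT)).
have ti : {within `[0, T], continuous (fun s => u x s)}.
  by apply: ct; exact: subset_itv_oo_cc.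
have D1 s : s \in `]0, T[ -> is_derive s (1 : R) (fun s => u x s) (dt u x s).
  by move=> sT; have [_ d] := du _ _ xd sT; exact: (derivable_is_derive1 d).
have D2 s : s \in `]0, T[ -> is_derive s (1 : R) (fun s => dt u x s) (dt (dt u) x s).
  by move=> sT; have [_ d] := ddt _ _ xd sT; exact: (derivable_is_derive1 d).
have t'in : t' \in `[0, T] by rewrite in_itv /= t'T (le_trans (ltW t0)).
have tm := time_taylor ti D1 D2 (fun s => M2P x s xd) tT t'in.
have dtE : dt u x t = Lqnl gamma delta u x t + f x t.
  by apply: (sol_equation hsol) => //; rewrite in_itv.
have tau0 : 0 <= t' - t by rewrite subr_ge0.
have h0 : 0 <= N%:R^-1 :> R by rewrite invr_ge0.
rewrite (ger0_norm tau0) in tm.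
have -> : u x t' - u x t - (t' - t) * (Lqnlh gamma N r w i + f x t) =
  (u x t' - u x t - (t' - t) * dt u x t)
  - (t' - t) * (Lqnlh gamma N r w i - Lqnl gamma delta u x t) by rewrite dtE; ring.
rewrite (le_trans (ler_normB _ _)) // (normrM (t' - t)) (ger0_norm tau0).
rewrite (le_trans (lerD tm (ler_wpM2l tau0 sp))) // -/C1.
have A : 0 <= M2 * (t' - t) * N%:R^-1 by rewrite !mulr_ge0.
have B : 0 <= C1 * (t' - t) * (t' - t) by rewrite !mulr_ge0.
have -> : (C1 + M2) * (t' - t) * (N%:R^-1 + (t' - t)) =
  (M2 * (t' - t) ^+ 2 + (t' - t) * (C1 * N%:R^-1))
  + (M2 * (t' - t) * N%:R^-1 + C1 * (t' - t) * (t' - t)) by ring.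
by rewrite lerDl addr_ge0.
Qed.

Theorem theorem3p1 (R : realType) (gamma : R -> R) (delta T : R)
    (f : R -> R -> R) (u0 : R -> R) (u : R -> R -> R)
    (hdelta : 0 < delta < 1) (hT : 0 < T)
    (hgamma : admissible_kernel gamma delta)
    (hsol : strong_solution gamma delta T f u0 u)
    (* The equation determines f for t > 0 only; the scheme also uses t = 0. *)
    (hf0 : forall x, x \in `]-1, 1[ -> f x t @[t --> 0^'+] --> f x 0)
    (hC2 : Ck_closed_rect 2 (-1 - delta) 1 0 T u)
    (* The amount of smoothness beyond C^2 that the rate Delta x requires;
       implied by a bounded third derivative in x. *)
    (hlip : exists K : R, forall t, t \in `]0, T[ ->
       K.-lipschitz_(`]-1 - delta, 1[) (fun x => dx (dx u) x t)) :
  exists C : R, forall N r NT : nat, (0 < N)%N -> (0 < NT)%N ->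
    delta = r%:R * N%:R^-1 ->
    forall (U : nat -> int -> R), discrete_solution gamma T f N r NT U ->
    forall n : nat, (n < NT)%N ->
    (forall i, interior_index N i ->
       u (gridx R N i) (n%:R * (T / NT%:R)) = U n i) ->
    forall i, interior_index N i ->
      `|U n.+1 i - u (gridx R N i) (n.+1%:R * (T / NT%:R))|
        <= C * (T / NT%:R) * (N%:R^-1 + T / NT%:R).
Proof.
have [C C0 trunc] := local_truncation_error hdelta hgamma hsol hC2 hlip.
have [d0 d1] := andP hdelta.
exists C => N r NT N0 NT0 dE U hU n nNT uU i iI.
pose tau := T / NT%:R; pose x := gridx R N i.
have tau0 : 0 < tau by rewrite divr_gt0 ?ltr0n.
have NTtau : NT%:R * tau = T by rewrite mulrC divfK // pnatr_eq0 -lt0n.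
have n1T : n.+1%:R * tau <= T by rewrite -NTtau ler_wpM2r ?(ltW tau0) // ler_nat.
have n1E : n.+1%:R * tau = n%:R * tau + tau by rewrite -natr1 mulrDl mul1r.
have n0 : 0 <= n%:R * tau by rewrite mulr_ge0 ?(ltW tau0).
have hN : N%:R / N%:R = 1 :> R by rewrite divff // pnatr_eq0 -lt0n.
have h0 : 0 < N%:R^-1 :> R by rewrite invr_gt0 ltr0n.
have rN : (0 < r < N)%N.
  by apply/andP; split; rewrite -(ltr_nat R) -(ltr_pM2r h0) -dE ?mul0r ?hN.
have gridU j : grid_index N r j -> U n j = u (gridx R N j) (n%:R * tau).
  move=> gj.
  have tin : n%:R * tau \in `[0, T].
    by rewrite in_itv /= n0 /= (le_trans _ n1T) // n1E lerDl ltW.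
  have /andP[x1 x2] := gridx_bounds N0 dE gj.
  have [jin|jbd] := grid_index_cases gj.
  - by rewrite uU.
  - rewrite (scheme_boundary hU) ?(ltnW nNT) // (sol_boundary hsol) //.
    case: jbd => [/andP[_ j0]|->]; [left|right].
    + rewrite in_itv /= x1 /= -[leRHS]addr0 -[X in _ + X](mul0r N%:R^-1).
      by rewrite -[0 in leRHS]/(0%:~R : R) -/(gridx R N 0) gridx_le.
    + by rewrite mul2n -addnn gridx_interface.
have UE : U n.+1 i = U n i + tau * (Lqnlh gamma N r (U n) i + f x (n%:R * tau)).
  by rewrite -(scheme_equation hU) // mulrC divfK ?subrKC // gt_eqF.
have [gi _ _] := grid_index_neighbours (proj1 (andP rN)) iI.
suff main : `|u x (n%:R * tau + tau) - u x (n%:R * tau)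
    - tau * (Lqnlh gamma N r (U n) i + f x (n%:R * tau))| <= C * tau * (N%:R^-1 + tau).
  by rewrite UE gridU // -/tau -/x n1E distrC opprD addrA.
(* The steps after the first start at a positive time. *)
have [n_eq0|n_gt0] := posnP n; last first.
  have := trunc N r N0 dE i (U n) (n%:R * tau) (n%:R * tau + tau) iI.
  rewrite (_ : n%:R * tau + tau - n%:R * tau = tau); last by ring.
  apply => //.
    by rewrite in_itv /= mulr_gt0 ?ltr0n //= (lt_le_trans _ n1T) // n1E ltrDl.
  by rewrite lerDl ltW // -n1E.
rewrite {}n_eq0 mul0r add0r in gridU n1T n1E UE *.
rewrite n1E in n1T.
have cu y : y \in `[-1 - delta, 1] -> u y t @[t --> 0^'+] --> u y 0.
  have [_ ct] := Ck_closed_rect_slices hC2.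
  by move=> /ct; rewrite continuous_within_itvP // => -[].
have xin : x \in `]-1, 1[ by rewrite in_itv /=; exact: gridx_interior.
have xcc : x \in `[-1 - delta, 1].
  by move: xin; rewrite !in_itv /= => /andP[? ?]; lra.
pose w t j := u (gridx R N j) t.
have cL : Lqnlh gamma N r (w t) i @[t --> 0^'+] --> Lqnlh gamma N r (U 0%N) i.
  apply: Lqnlh_cvg => // j gj; rewrite gridU //.
  by apply: cu; rewrite in_itv /=; exact: gridx_bounds gj.
have ctau : tau - t @[t --> 0^'+] --> tau - 0.
  by apply: cvgB; [exact: cvg_cst|exact: cvg_at_right_filter].
rewrite subr0 in ctau.
apply: (ler_cvg_to (a := (0 : R)^'+)
  (f := fun t => `|u x tau - u x t
     - (tau - t) * (Lqnlh gamma N r (w t) i + f x t)|)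
  (g := fun t => C * (tau - t) * (N%:R^-1 + (tau - t)))).
- have A : u x tau - u x t @[t --> 0^'+] --> u x tau - u x 0.
    exact: (cvgB (cvg_cst _) (cu _ xcc)).
  have B : (tau - t) * (Lqnlh gamma N r (w t) i + f x t) @[t --> 0^'+] -->
      tau * (Lqnlh gamma N r (U 0%N) i + f x 0).
    exact: (cvgM ctau (cvgD cL (hf0 _ xin))).
  exact: (cvg_norm (cvgB A B)).
- have A : C * (tau - t) @[t --> 0^'+] --> C * tau by exact: (cvgM (cvg_cst _) ctau).
  by apply: (cvgM A); exact: (cvgD (cvg_cst _) ctau).
near=> t.
apply: trunc => //.
  by rewrite in_itv /=; apply/andP; split; near: t; [exact: nbhs_right_gt|exact: nbhs_right_lt].
rewrite n1T andbT ltW //; near: t; exact: nbhs_right_lt.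
Unshelve. all: by end_near.
Qed.
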